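(* Let $T$ be a Kurepa tree, let $\mathcal{S},\mathcal{T}$ be appropriate for $\omega,\omega_1,H(\omega_2)$, and let $\mathbb{S}$ be the sealing poset of $T$. Let $\mathbb{Q}$ be a forcing notion in the ground model $V$ and let $\dot b$ be a $\mathbb{Q}$-name such that $\mathbb{Q}\Vdash \dot{b}\subset \check{T}$ is a new branch (a branch of $T$ not in $V$). Then $$\mathbb{S}\times \mathbb{Q}\Vdash \left|\check{\omega}_1^V\right| = \aleph_0 .$$
   Context: An $\omega_1$-tree is a tree of height $\omega_1$ with countable levels; trees are rooted. Branch means cofinal branch, $[T]$ is the set of branches of $T$ (in the ground model), and a Kurepa tree is an $\omega_1$-tree with $|[T]|=\aleph_2$. $\mathrm{Lev}(x)$ is the level of $x\in T$, and $\mathrm{Lev}(b)=\omega_1$ for $b\in[T]$. The order $\leq_T$ is extended to $T\cup[T]$ by putting $x\leq_T b$ iff $x\in b$, for $x\in T$, $b\in[T]$. The meet $x\wedge y$ of $x,y\in T\cup[T]$ is the greatest element below both; meets are assumed to exist. Models: $\mathcal{S}$ and $\mathcal{T}$ are appropriate for $\omega,\omega_1,H(\omega_2)$ if: (1) $\mathcal{T}$ is a collection of transitive $W\prec H(\omega_2)$ and $\mathcal{S}$ is a collection of countable $M\prec H(\omega_2)$, and every $N\in\mathcal{S}\cup\mathcal{T}$ satisfies $N\in H(\omega_2)$ and $\omega,\omega_1\in N$; (2) if $M_1,M_2\in\mathcal{S}$ and $M_1\in M_2$ then $M_1\subset M_2$; (3) if $W\in\mathcal{T}$, $M\in\mathcal{S}$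 and $W\in M$ then $M\cap W\in W$ and $M\cap W\in\mathcal{S}$; (4) each $W\in\mathcal{T}$ is closed under finite sequences. It is assumed that $T\in H(\omega_2)$ and $T\in N$ for every $N\in\mathcal{S}\cup\mathcal{T}$. $\mathbb{M}$ is the set of finite sequences $\langle M_m\mid m<n\rangle$ of members of $\mathcal{S}\cup\mathcal{T}$ with $M_{m-1}\in M_m$ for $0<m<n$ and closed under intersections (each $M_k\cap M_m$ is in the sequence), ordered by $p\leq q$ iff every model of $q$ occurs in $p$. The sealing poset $\mathbb{S}$ of $T$: conditions are pairs $p=\langle f_p,\vec M_p\rangle$ where $f_p$ is a finite partial function from $T\cup[T]$ to $\omega$ and $\vec M_p\in\mathbb{M}$, such that: (1) (weak monotonicity) if $x,y\in\mathrm{dom} f_p$ and $x\leq_T y$ (including the case $y\in[T]$, $x\in y$) then $f_p(x)\leq f_p(y)$; (2) (closure under branches) for all $N\in\vec M_p$ and every branch $b\in N\cap[T]$, if there is $t\in(\mathrm{dom} f_p\setminus N)\cap b$ then $b\in\mathrm{dom} f_p$ and $f_p(b)=f_p(t)$ for any such $t$; (3) (closure under meets) if $x_1,x_2\in\mathrm{dom} f_p$ then $x_1\wedge x_2\in\mathrm{dom} f_p$; (4) the root of $T$ is in $\mathrm{dom} f_p$ and has value $0$. The order is reverse inclusion: $p\leq q$ iff $f_p\supseteq f_q$ and $\vec M_p\supseteq\vec M_q$ (as sets of models). *)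

(* Defs.v *)
From HB Require Import structures.
From mathcomp Require Import all_boot.
From mathcomp Require Import all_classical.

Set Implicit Arguments.
Unset Strict Implicit.
Unset Printing Implicit Defensive.

Local Open Scope classical_set_scope.
Local Open Scope card_scope.
Local Open Scope quotient_scope.

(* The ground model V is the type of iterative sets (well-founded trees with    *)
(* branching in smallType) modulo extensional equality.  Being a single         *)
(* constant, smallType denotes one fixed universe: the types in it are, up to   *)
(* bijection, the sets of V, whereas V and all proper classes (set V) live      *)
(* above it.                                                                    *)
Definition smallType := Type.

Inductive preset : Type := PSup (A : smallType) of (A -> preset).

Fixpoint eqset (x y : preset) : Prop :=
  match x, y with
  | PSup A f, PSup B g =>
      (forall a, exists b, eqset (f a) (g b)) /\
      (forall b, exists a, eqset (f a) (g b))
  end.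

Lemma eqset_refl x : eqset x x.
Proof. by elim: x => A f IH /=; split=> a; exists a. Qed.

Lemma eqset_sym x y : eqset x y -> eqset y x.
Proof.
elim: x y => A f IH [B g] /= [fg gf]; split.
  by move=> b; have [a /IH] := gf b; exists a.
by move=> a; have [b /IH] := fg a; exists b.
Qed.

Lemma eqset_trans x y z : eqset x y -> eqset y z -> eqset x z.
Proof.
elim: x y z => A f IH [B g] [C h] /= [fg gf] [gh hg]; split.
  by move=> a; have [b e] := fg a; have [c /(IH _ _ _ e)] := gh b; exists c.
by move=> c; have [b e] := hg c; have [a /IH/(_ e)] := gf b; exists a.
Qed.

HB.instance Definition _ := gen_eqMixin preset.
HB.instance Definition _ := gen_choiceMixin preset.

Definition eqsetb : rel preset := fun x y => `[< eqset x y >].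

Lemma eqsetb_refl : reflexive eqsetb.
Proof. by move=> x; apply/asboolP/eqset_refl. Qed.

Lemma eqsetb_sym : symmetric eqsetb.
Proof. by move=> x y; apply/asboolP/asboolP => /eqset_sym. Qed.

Lemma eqsetb_trans : transitive eqsetb.
Proof.
by move=> y x z /asboolP xy /asboolP yz; apply/asboolP; apply: eqset_trans yz.
Qed.

Canonical eqset_equiv := EquivRel eqsetb eqsetb_refl eqsetb_sym eqsetb_trans.

Definition V := {eq_quot eqset_equiv}.
HB.instance Definition _ := Choice.on V.

Lemma pi_eqset (x y : preset) : \pi_V x = \pi_V y <-> eqset x y.
Proof.
split=> [/(@eqmodP _ eqset_equiv)/asboolP //|xy].
by apply/(@eqmodP _ eqset_equiv)/asboolP.
Qed.

Definition Index (x : V) : smallType := let: PSup A _ := repr x in A.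

Definition elt (x : V) : Index x -> V :=
  match repr x as p return (let: PSup A _ := p in A) -> V with
  | PSup A f => fun a => \pi_V (f a)
  end.

Definition inV (x y : V) : Prop := exists i, @elt y i = x.
Notation "x ∈ y" := (inV x y) (at level 70, no associativity).

Definition elts (y : V) : set V := [set x | x ∈ y].

Lemma inV_pi (A : smallType) (f : A -> preset) y :
  y ∈ \pi_V (PSup f) <-> exists a, \pi_V (f a) = y.
Proof.
have /pi_eqset := reprK (\pi_V (PSup f)).
rewrite /inV /elt /Index; case: (repr _) => B g /= [gf fg]; split.
  by move=> [b <-]; have [a e] := gf b; exists a; apply/pi_eqset/eqset_sym.
by move=> [a <-]; have [b e] := fg a; exists b; apply/pi_eqset.
Qed.

Lemma elts_inj : injective elts.
Proof.
move=> x y; rewrite -[x]reprK -[y]reprK.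
case: (repr x) => A f; case: (repr y) => B g /seteqP[xy yx].
apply/pi_eqset; split.
  move=> a; have /inV_pi[b /pi_eqset e] : \pi_V (f a) ∈ \pi_V (PSup g).
    by apply/xy/inV_pi; exists a.
  by exists b; apply: eqset_sym.
move=> b; have /inV_pi[a /pi_eqset e] : \pi_V (g b) ∈ \pi_V (PSup f).
  by apply/yx/inV_pi; exists b.
by exists a.
Qed.

Lemma inV_ind (P : V -> Prop) :
  (forall x, (forall y, y ∈ x -> P y) -> P x) -> forall x, P x.
Proof.
move=> IP x; rewrite -[x]reprK; elim: (repr x) => A f IH.
by apply: IP => y /inV_pi[a <-].
Qed.

Definition is_small (A : set V) : Prop :=
  exists (I : smallType) (f : I -> V), A `<=` range f.

Definition emptyV : V := \pi_V (PSup (fun i : void => match i with end)).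
HB.instance Definition _ := isPointed.Build V emptyV.

(* The set with the elements of the class A; a junk value if A is a proper class. *)
Definition set_of (A : set V) : V := xget emptyV [set x | elts x = A].

Lemma elts_set_of (A : set V) : is_small A -> elts (set_of A) = A.
Proof.
move=> [I [f Af]]; apply: (@xgetPex _ emptyV [set x | elts x = A]).
pose J : smallType := {i : I | A (f i)}.
exists (\pi_V (PSup (fun j : J => repr (f (sval j))))).
apply/seteqP; split=> y.
  by move=> /inV_pi[[i Ai] <-]; rewrite reprK.
move=> Ay; have [i _ fi] := Af y Ay; rewrite -fi in Ay *.
by apply/inV_pi; exists (exist _ i Ay); rewrite reprK.
Qed.

Lemma small_sub (A B : set V) : A `<=` B -> is_small B -> is_small A.
Proof. by move=> AB [I [f Bf]]; exists I, f; apply: subset_trans Bf. Qed.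

Lemma small_range (I : smallType) (f : I -> V) : is_small (range f).
Proof. by exists I, f. Qed.

Lemma small_elts x : is_small (elts x).
Proof. by exists (Index x), (@elt x) => y [i <-]; exists i. Qed.

Lemma small_image (f : V -> V) A : is_small A -> is_small (f @` A).
Proof.
move=> [I [g Ag]]; exists I, (f \o g) => _ [x /Ag[i _ <-] <-]; by exists i.
Qed.

Definition upair (x y : V) : V := set_of [set x; y].
Definition opair (x y : V) : V := upair (upair x x) (upair x y).

Lemma elts_upair x y : elts (upair x y) = [set x; y].
Proof.
apply: elts_set_of; exists bool, (fun b => if b then x else y) => z [->|->].
  by exists true.
by exists false.
Qed.

Lemma opair_inj x y x' y' : opair x y = opair x' y' -> x = x' /\ y = y'.
Proof.
have upair1 u v w : upair u u = upair v w -> u = v /\ u = w.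
  move=> /(congr1 elts); rewrite !elts_upair => /seteqP[_ s].
  by split; [have [] := s v (or_introl erefl) | have [] := s w (or_intror erefl)].
move=> /(congr1 elts); rewrite !elts_upair => /seteqP[s s'].
have xx : x = x'.
  have [|/upair1[]//] := s _ (or_introl erefl).
  by move=> /upair1[].
split=> //; subst x'.
have [/esym/upair1[_ xy]|/(congr1 elts)] := s _ (or_intror erefl).
  have [/esym/upair1[_ xy']|] := s' _ (or_intror erefl); first by rewrite -xy.
  by rewrite -xy => /esym /upair1 [].
rewrite !elts_upair => /seteqP[t t'].
have [e|//] := t _ (or_intror erefl).
by have [e'|->//] := t' _ (or_intror erefl); rewrite e' e.
Qed.

Fixpoint natV (n : nat) : V :=
  if n is m.+1 then set_of (elts (natV m) `|` [set natV m]) else emptyV.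

Definition omega : V := set_of (range natV).

Lemma elts_emptyV : elts emptyV = set0.
Proof.
by rewrite -subset0 => y /inV_pi[[]].
Qed.

Lemma elts_natVS n : elts (natV n.+1) = elts (natV n) `|` [set natV n].
Proof.
apply: elts_set_of.
exists (option (Index (natV n))), (fun o => if o is Some i then elt i else natV n).
by move=> x [[i <-]|->]; [exists (Some i) | exists None].
Qed.

Lemma elts_omega : elts omega = range natV.
Proof. by apply: elts_set_of; apply: small_range. Qed.

Definition transitiveV (x : V) : Prop := forall y, y ∈ x -> elts y `<=` elts x.

Definition ordinal (x : V) : Prop :=
  transitiveV x /\ forall y, y ∈ x -> transitiveV y.

(* The ordinals of cardinality at most |x|, i.e. the least cardinal above |x|. *)
Definition hartogs (x : V) : V :=
  set_of [set a | ordinal a /\ elts a #<= elts x].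

Definition omega1 : V := hartogs omega.
Definition omega2 : V := hartogs omega1.

Lemma transitiveV_rigid (a b : V) (g h : V -> V) :
  transitiveV a -> transitiveV b ->
  {in elts a &, injective g} -> {in elts b &, injective h} ->
  [set uv | [/\ uv.1 ∈ a, uv.2 ∈ a & uv.1 ∈ uv.2 \/ uv.1 = uv.2]]
  `<=` [set uv | exists u' v', [/\ g uv.1 = h u', g uv.2 = h v', u' ∈ b,
                                   v' ∈ b & u' ∈ v' \/ u' = v']] ->
  [set uv | [/\ uv.1 ∈ b, uv.2 ∈ b & uv.1 ∈ uv.2 \/ uv.1 = uv.2]]
  `<=` [set uv | exists u' v', [/\ h uv.1 = g u', h uv.2 = g v', u' ∈ a,
                                   v' ∈ a & u' ∈ v' \/ u' = v']] ->
  a = b.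
Proof.
move=> ta tb gi hi ab ba.
have irr x : ~ x ∈ x.
  by elim/inV_ind: x => x IH xx; exact: (IH x xx xx).
have key u : forall w, u ∈ a -> w ∈ b -> g u = h w -> u = w.
  elim/inV_ind: u => u IH w ua wb gh; apply: elts_inj; apply/seteqP; split=> z /= zu.
    have za : z ∈ a by exact: ta zu.
    have /= [|z' [w' []]] := ab (z, u); first by split=> //; left.
    move=> gz gu z'b w'b; rewrite gh in gu.
    have <- : w = w' by apply: hi gu; rewrite ?inE.
    have -> : z = z' by exact: IH gz.
    case=> // zw; move: gz; rewrite zw -gh => /gi zu'.
    by case: (irr u); rewrite -{1}zu' ?inE.
  have zb : z ∈ b by exact: tb zu.
  have /= [|z' [u' []]] := ba (z, w); first by split=> //; left.
  move=> hz hw z'a u'a; rewrite -gh in hw.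
  have <- : u = u' by apply: gi hw; rewrite ?inE.
  case=> zu'; first by rewrite -(IH z' zu' z z'a zb) //.
  move: hz; rewrite zu' gh => /hi zw.
  by case: (irr w); rewrite -{1}zw ?inE.
apply: elts_inj; apply/seteqP; split=> z /= zz.
  have /= [|z' [w' [e _ z'b _ _]]] := ab (z, z); first by split=> //; right.
  by rewrite (key z z').
have /= [|z' [w' [e _ z'a _ _]]] := ba (z, z); first by split=> //; right.
by rewrite -(key z' z).
Qed.

Lemma elts_hartogs x :
  elts (hartogs x) = [set a | ordinal a /\ elts a #<= elts x].
Proof.
apply: elts_set_of.
pose code (S : Index x -> Index x -> Prop) (a : V) := transitiveV a /\
  exists g : V -> V, [/\ set_fun (elts a) (elts x) g,
    {in elts a &, injective g} & forall i j, S i j <-> exists u v,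
      [/\ g u = elt i, g v = elt j, u ∈ a, v ∈ a & u ∈ v \/ u = v]].
have code_inj S a b : code S a -> code S b -> a = b.
  move=> [ta [g [gx gi gS]]] [tb [h [hx hi hS]]].
  apply: (transitiveV_rigid ta tb gi hi) => -[u v] /= [ua va uv].
    have [i iu] := gx u ua; have [j jv] := gx v va.
    have /hS[u' [v' [hu' hv' *]]] : S i j by apply/gS; exists u, v; split.
    by exists u', v'; rewrite -iu -jv.
  have [i iu] := hx u ua; have [j jv] := hx v va.
  have /gS[u' [v' [gu' gv' *]]] : S i j by apply/hS; exists u, v; split.
  by exists u', v'; rewrite -iu -jv.
pose I : smallType := Index x -> Index x -> Prop.
exists I, (fun S => xget emptyV (code S)) => a [[ta _] /pcard_leP[g]].
pose S (i j : Index x) := exists u v,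
  [/\ g u = elt i, g v = elt j, u ∈ a, v ∈ a & u ∈ v \/ u = v].
have Sa : code S a by split=> //; exists g.
by exists S => //; apply: (xget_unique _ Sa) => b Sb; exact: code_inj Sa.
Qed.

(* The finite sequence s as an element of V: a function with domain size s. *)
Definition seqV (s : seq V) : V :=
  set_of [set opair (natV i) (nth emptyV s i) | i in [set i | i < size s]].

Lemma elts_seqV s : elts (seqV s) =
  [set opair (natV i) (nth emptyV s i) | i in [set i | i < size s]].
Proof.
apply: elts_set_of; exists nat, (fun i => opair (natV i) (nth emptyV s i)).
by move=> _ [i _ <-]; exists i.
Qed.

Definition trcl (x : V) : set V :=
  [set y | forall t, transitiveV t -> elts x `<=` elts t -> y ∈ t].

(* H(omega_2): the sets whose transitive closure has fewer than aleph_2 elements. *)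
Definition Homega2 : set V := [set x | ~~ (elts omega2 #<= trcl x)].

(* First-order formulas of the language of set theory, in de Bruijn notation:  *)
(* under fAll, index 0 is the bound variable and n.+1 is the former n.         *)

Inductive formula : Type :=
| fMem of nat & nat
| fEq of nat & nat
| fNot of formula
| fAnd of formula & formula
| fAll of formula.

Definition fOr a b := fNot (fAnd (fNot a) (fNot b)).
Definition fImp a b := fNot (fAnd a (fNot b)).
Definition fIff a b := fAnd (fImp a b) (fImp b a).
Definition fEx a := fNot (fAll (fNot a)).

Definition scons (X : Type) (x : X) (v : nat -> X) : nat -> X :=
  fun n => if n is m.+1 then v m else x.

Fixpoint sat (A : set V) (v : nat -> V) (phi : formula) : Prop :=
  match phi with
  | fMem i j => v i ∈ v j
  | fEq i j => v i = v j
  | fNot a => ~ sat A v a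
  | fAnd a b => sat A v a /\ sat A v b
  | fAll a => forall x, A x -> sat A (scons x v) a
  end.

Definition elementary (A B : set V) : Prop :=
  [/\ A !=set0, A `<=` B &
    forall (phi : formula) (v : nat -> V),
      (forall n, A (v n)) -> (sat A v phi <-> sat B v phi)].

(* z = {x, y};  z = (x, y);  (x, y) in r *)
Definition f_upair z x y := fAll (fIff (fMem 0 z.+1) (fOr (fEq 0 x.+1) (fEq 0 y.+1))).
Definition f_opair z x y :=
  fEx (fEx (fAnd (f_upair 1 x.+2 x.+2)
           (fAnd (f_upair 0 x.+2 y.+2) (f_upair z.+2 1 0)))).
Definition f_rel r x y := fEx (fAnd (f_opair 0 x.+1 y.+1) (fMem 0 r.+1)).

(* f is a bijection from a onto b *)
Definition f_bij f a b :=
  fAnd (fAll (fImp (fMem 0 f.+1)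
    (fEx (fEx (fAnd (fMem 1 a.+3) (fAnd (fMem 0 b.+3) (f_opair 2 1 0)))))))
  (fAnd (fAll (fImp (fMem 0 a.+1)
    (fEx (fAll (fIff (f_rel f.+3 2 0) (fEq 0 1))))))
  (fAll (fImp (fMem 0 b.+1)
    (fEx (fAll (fIff (f_rel f.+3 0 2) (fEq 0 1))))))).

(* |a| = |b| *)
Definition f_equinumerous a b := fEx (f_bij 0 a.+1 b.+1).

(* b is a cofinal branch of the tree (T, R) whose set of levels is L:  a       *)
(* downward closed chain of T that meets every level.                         *)
Definition f_branch b T R L :=
  fAnd (fAll (fImp (fMem 0 b.+1) (fMem 0 T.+1)))
  (fAnd (fAll (fAll (fImp (fAnd (fMem 1 b.+2) (fMem 0 b.+2))
                          (fOr (f_rel R.+2 1 0) (f_rel R.+2 0 1)))))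
  (fAnd (fAll (fAll (fImp (fAnd (fMem 1 b.+2) (fAnd (fMem 0 T.+2) (f_rel R.+2 0 1)))
                          (fMem 0 b.+2))))
  (fAll (fImp (fMem 0 L.+1) (fEx (fAnd (fMem 0 1) (fMem 0 b.+2))))))).

(* In le q p, the condition q is the stronger one.                            *)

Definition forcing_notion (P : Type) (le : P -> P -> Prop) : Prop :=
  [/\ (exists p : P, True), (forall p, le p p) &
    forall p q r, le p q -> le q r -> le p r].

(* Name f c is the P-name consisting of the pairs (f a, p) with c a p; thus the *)
(* check name of x has all pairs (check y, p) with y in x and p a condition.    *)
Inductive PName (P : Type) : Type :=
  Name (A : smallType) of (A -> PName P) & (A -> P -> Prop).

Fixpoint check_preset (P : Type) (x : preset) : PName P :=
  let: PSup A f := x in Name (fun a => check_preset P (f a)) (fun _ _ => True).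

Definition check (P : Type) (x : V) : PName P := check_preset P (repr x).

Definition dense_below (P : Type) (le : P -> P -> Prop) (p : P) (D : set P) : Prop :=
  forall q, le q p -> exists2 r, le r q & D r.

Section Forces.
Context (P : Type) (le : P -> P -> Prop).

(* p forces x = y iff for (s, p') in x, every q below p and p' forces s in y,  *)
(* and symmetrically (the clause forces_mem below is inlined).                 *)
Fixpoint forces_eq (x y : PName P) (p : P) {struct x} : Prop :=
  match x, y with
  | Name A f c, Name B g d =>
      (forall a p' q, c a p' -> le q p -> le q p' ->
        dense_below le q [set r | exists b q',
          [/\ d b q', le r q' & forces_eq (f a) (g b) r]]) /\
      (forall b p' q, d b p' -> le q p -> le q p' ->
        dense_below le q [set r | exists a q',
          [/\ c a q', le r q' & forces_eq (f a) (g b) r]])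
  end.

Definition forces_mem (x y : PName P) (p : P) : Prop :=
  let: Name B g d := y in
  dense_below le p [set r | exists b q',
    [/\ d b q', le r q' & forces_eq x (g b) r]].

Fixpoint forces (p : P) (v : nat -> PName P) (phi : formula) : Prop :=
  match phi with
  | fMem i j => forces_mem (v i) (v j) p
  | fEq i j => forces_eq (v i) (v j) p
  | fNot a => forall q, le q p -> ~ forces q v a
  | fAnd a b => forces p v a /\ forces p v b
  | fAll a => forall x : PName P, forces p (scons x v) a
  end.

(* P forces phi(s_0, ..., s_(n-1)) *)
Definition forced (phi : formula) (s : seq (PName P)) : Prop :=
  forall p, forces p (nth (check P emptyV) s) phi.

End Forces.

Definition prod_le (P Q : Type) (leP : P -> P -> Prop) (leQ : Q -> Q -> Prop) :
    P * Q -> P * Q -> Prop :=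
  fun p q => leP p.1 q.1 /\ leQ p.2 q.2.

(* A tree is given by its underlying set T and its (reflexive) order   *)
(* R, a set of ordered pairs.                                                  *)

Section Trees.
Context (T R : V).

Definition leT (x y : V) : Prop := opair x y ∈ R.

Definition below (x : V) : set V := [set y | leT y x /\ y <> x].

Definition is_tree : Prop :=
  [/\ elts R `<=` [set opair x y | x in elts T & y in elts T],
      (forall x, x ∈ T -> leT x x),
      (forall x y, leT x y -> leT y x -> x = y),
      (forall x y z, leT x y -> leT y z -> leT x z) &
      forall x, x ∈ T -> forall A, A `<=` below x -> A !=set0 ->
        exists2 m, A m & forall y, A y -> leT m y].

(* The nodes at level a: those whose predecessors have order type a. *)
Definition level (a : V) : set V :=
  [set x | x ∈ T /\ exists2 g : V -> V, set_bij (elts a) (below x) g &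
     forall i j, i ∈ a -> j ∈ a -> (i ∈ j <-> below (g j) (g i))].

Definition is_root (r : V) : Prop := r ∈ T /\ forall x, x ∈ T -> leT r x.

Definition omega1_tree : Prop :=
  [/\ is_tree, (exists r, is_root r),
      (forall x, x ∈ T -> exists2 a, a ∈ omega1 & level a x),
      (forall a, a ∈ omega1 -> level a !=set0) &
      forall a, a ∈ omega1 -> countable (level a)].

Definition levels : V := set_of [set set_of (level a) | a in elts omega1].

Lemma elts_level a : elts (set_of (level a)) = level a.
Proof. by apply/elts_set_of/small_sub/(small_elts T) => x []. Qed.

Lemma elts_levels : elts levels = [set set_of (level a) | a in elts omega1].
Proof. exact/elts_set_of/small_image/small_elts. Qed.

Definition branches : set V :=
  [set b | [/\ elts b `<=` elts T,
     (forall x y, x ∈ b -> y ∈ b -> leT x y \/ leT y x),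
     (forall x y, x ∈ b -> leT y x -> y ∈ b) &
     forall a, a ∈ omega1 -> exists2 x, level a x & x ∈ b]].

Definition kurepa_tree : Prop := omega1_tree /\ branches #= elts omega2.

End Trees.

(* The disjoint union of T and [T] (a node of T may happen to be, as a set, a  *)
(* branch of T).                                                               *)
Inductive point : Type := Node of V | Branch of V.

Section Sealing.
Context (T R : V).

Definition is_point (x : point) : Prop :=
  match x with Node t => t ∈ T | Branch b => branches T R b end.

Definition lept (x y : point) : Prop :=
  match x, y with
  | Node s, Node t => leT R s t
  | Node s, Branch b => s ∈ b
  | Branch _, Node _ => False
  | Branch b, Branch c => b = c
  end.

Definition is_meet (x y z : point) : Prop :=
  [/\ is_point z, lept z x, lept z y &
    forall w, is_point w -> lept w x -> lept w y -> lept w z].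

Definition has_meets : Prop :=
  forall x y, is_point x -> is_point y -> exists z, is_meet x y z.

End Sealing.

Definition appropriate (SS TT : set V) : Prop :=
  [/\ [/\ (forall W, TT W -> transitiveV W /\ elementary (elts W) Homega2),
          (forall M, SS M -> countable (elts M) /\ elementary (elts M) Homega2) &
          forall N, (SS `|` TT) N -> [/\ Homega2 N, omega ∈ N & omega1 ∈ N]],
      (forall M1 M2, SS M1 -> SS M2 -> M1 ∈ M2 -> elts M1 `<=` elts M2),
      (forall W M, TT W -> SS M -> W ∈ M ->
         let MW := set_of (elts M `&` elts W) in MW ∈ W /\ SS MW) &
      forall W, TT W -> forall s : seq V, (forall x, x \in s -> x ∈ W) -> seqV s ∈ W].

Lemma elts_inter x y : elts (set_of (elts x `&` elts y)) = elts x `&` elts y.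
Proof. by apply/elts_set_of/small_sub/(small_elts x) => z []. Qed.

Definition model_seq (SS TT : set V) (s : seq V) : Prop :=
  [/\ (forall M, M \in s -> (SS `|` TT) M),
      (forall m, m.+1 < size s -> nth emptyV s m ∈ nth emptyV s m.+1) &
      forall K M, K \in s -> M \in s -> set_of (elts K `&` elts M) \in s].

Record condition := Condition { cfun : point -> option nat; cmodels : seq V }.

Definition cdom (p : condition) : set point := [set x | cfun p x <> None].

Definition sealing_condition (T R : V) (SS TT : set V) (p : condition) : Prop :=
  [/\ [/\ finite_set (cdom p), cdom p `<=` is_point T R &
          model_seq SS TT (cmodels p)],
      (forall x y m n, cfun p x = Some m -> cfun p y = Some n -> lept R x y ->
         m <= n),
      (forall N b t, N \in cmodels p -> b ∈ N -> branches T R b ->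
         cdom p (Node t) -> ~ t ∈ N -> t ∈ b ->
         cdom p (Branch b) /\ cfun p (Branch b) = cfun p (Node t)),
      (forall x y z, cdom p x -> cdom p y -> is_meet T R x y z -> cdom p z) &
      forall r, is_root T R r -> cfun p (Node r) = Some 0].

(* Although this type lives above smallType, up to reordering the sequence of  *)
(* models and up to the representation of finite functions its elements form a *)
(* set of V, so that the names over it are the usual ones.                     *)
Definition sealing (T R : V) (SS TT : set V) : Type :=
  {p : condition | sealing_condition T R SS TT p}.

Definition sealing_le (T R : V) (SS TT : set V) (p q : sealing T R SS TT) : Prop :=
  (forall x n, cfun (sval q) x = Some n -> cfun (sval p) x = Some n) /\
  (forall M, M \in cmodels (sval q) -> M \in cmodels (sval p)).

(* The formulas above define the intended notions in V, and the forcing relation *)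
(* decides equality of check names correctly.                                   *)

Lemma inVE x y : (x ∈ y) = elts y x. Proof. by []. Qed.

Lemma sat_fAnd A v a b : sat A v (fAnd a b) <-> sat A v a /\ sat A v b.
Proof. by []. Qed.

Lemma sat_fImp A v a b : sat A v (fImp a b) <-> (sat A v a -> sat A v b).
Proof. by rewrite /=; split=> [h sa|h [sa]]; [apply: contrapT => nb; apply: h | apply; apply: h]. Qed.

Lemma sat_fOr A v a b : sat A v (fOr a b) <-> (sat A v a \/ sat A v b).
Proof.
rewrite /=; split=> [h|[s|s] []//].
by apply: contrapT => n; apply: h; split=> s; apply: n; [left | right].
Qed.

Lemma sat_fIff A v a b : sat A v (fIff a b) <-> (sat A v a <-> sat A v b).
Proof. by split=> [[/sat_fImp ab /sat_fImp ba]|[ab ba]]; [split | split; apply/(sat_fImp A v)]. Qed.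

Lemma sat_fEx v a : sat setT v (fEx a) <-> exists x, sat setT (scons x v) a.
Proof.
rewrite /=; split=> [h|[x sx] /(_ x I)//].
by apply: contrapT => n; apply: h => x _ sx; apply: n; exists x.
Qed.

Lemma sat_fAll v a : sat setT v (fAll a) <-> forall x, sat setT (scons x v) a.
Proof. by split=> [h x|h x _]; apply: h. Qed.

Lemma sat_upair v z x y : sat setT v (f_upair z x y) <-> v z = upair (v x) (v y).
Proof.
split=> [h|e].
  apply: elts_inj; rewrite elts_upair; apply/seteqP; split=> w.
    by have /sat_fAll/(_ w)/sat_fIff h1 := h; move=> /(iffLR h1)/sat_fOr.
  by have /sat_fAll/(_ w)/sat_fIff h1 := h; move=> hw; apply/(iffRL h1)/sat_fOr.
apply/sat_fAll => w; have ew : w ∈ v z <-> w = v x \/ w = v y.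
  by rewrite e; change (elts (upair (v x) (v y)) w <-> [set v x; v y] w); rewrite elts_upair.
apply/sat_fIff; split; last by move=> /sat_fOr; apply: (iffRL ew).
by move=> /(iffLR ew) h; apply/sat_fOr.
Qed.

Lemma sat_opair v z x y : sat setT v (f_opair z x y) <-> v z = opair (v x) (v y).
Proof.
split=> [/sat_fEx[s /sat_fEx[t /sat_fAnd[/sat_upair es /sat_fAnd[/sat_upair et /sat_upair ez]]]]|e].
  by move: es et ez => /= -> -> ->.
apply/sat_fEx; exists (upair (v x) (v x)); apply/sat_fEx; exists (upair (v x) (v y)).
by do 2?[apply/sat_fAnd; split]; apply/sat_upair.
Qed.

Lemma sat_rel v r x y : sat setT v (f_rel r x y) <-> opair (v x) (v y) ∈ v r.
Proof.
split=> [/sat_fEx[z /sat_fAnd[/sat_opair/= <-]]//|h].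
by apply/sat_fEx; exists (opair (v x) (v y)); apply/sat_fAnd; split=> //; apply/sat_opair.
Qed.

Lemma sat_equinumerous v a b : sat setT v (f_equinumerous a b) <->
  (elts (v a) #= elts (v b)).
Proof.
split=> [/sat_fEx[f /sat_fAnd[/sat_fAll fab /sat_fAnd[/sat_fAll fa /sat_fAll fb]]]|].
  have {}fab x y : opair x y ∈ f -> x ∈ v a /\ y ∈ v b.
    move=> xyf; have /sat_fImp/(_ xyf)/sat_fEx[x' /sat_fEx[y' /sat_fAnd[xa /sat_fAnd[yb]]]] := fab (opair x y).
    by move=> /sat_opair/= /opair_inj[-> ->].
  have uniqx x : x ∈ v a -> exists y, forall y', opair x y' ∈ f <-> y' = y.
    move=> xa; have /sat_fImp/(_ xa)/sat_fEx[y /sat_fAll yP] := fa x.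
    exists y => y'; have /sat_fIff h := yP y'.
    by split=> [?|e]; [apply: (iffLR h); apply/sat_rel | have /sat_rel := iffRL h e].
  have uniqy y : y ∈ v b -> exists x, forall x', opair x' y ∈ f <-> x' = x.
    move=> yb; have /sat_fImp/(_ yb)/sat_fEx[x /sat_fAll xP] := fb y.
    exists x => x'; have /sat_fIff h := xP x'.
    by split=> [?|e]; [apply: (iffLR h); apply/sat_rel | have /sat_rel := iffRL h e].
  pose g x := xget emptyV [set y | opair x y ∈ f].
  have gP x : x ∈ v a -> opair x (g x) ∈ f.
    move=> xa; have [y yP] := uniqx x xa.
    apply: (@xgetPex _ emptyV [set y | opair x y ∈ f]); exists y.
    by have [_ /(_ erefl)] := yP y.
  suff : set_bij (elts (v a)) (elts (v b)) g.
    by move=> gb; apply/pcard_eqP/bijPex; exists g.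
  split.
  - by move=> x xa; have [] := fab _ _ (gP x xa).
  - move=> x x' /set_mem xa /set_mem x'a gg.
    have [yb y'b] := fab _ _ (gP x xa).
    have [x0 x0P] := uniqy _ y'b.
    have [h1 _] := x0P x; have [h2 _] := x0P x'.
    by rewrite (h1 (gP x xa)) h2 // gg; exact: gP.
  - move=> y yb; have [x xP] := uniqy y yb.
    have [_ /(_ erefl) xyf] := xP x; have [xa _] := fab _ _ xyf.
    exists x => //; have [y0 y0P] := uniqx x xa.
    by have [h1 _] := y0P (g x); have [h2 _] := y0P y; rewrite (h1 (gP x xa)) h2.
move=> /pcard_eqP/bijPex[g [gf gi gs]].
pose F := [set opair x (g x) | x in elts (v a)].
have eF : elts (set_of F) = F by apply: elts_set_of; apply: small_image; exact: small_elts.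
have FP x y : opair x y ∈ set_of F <-> x ∈ v a /\ y = g x.
  rewrite inVE eF; split=> [[x' xa /opair_inj[<- <-]]//|[xa ->]].
  by exists x.
apply/sat_fEx; exists (set_of F); do 2?[apply/sat_fAnd; split].
- apply/sat_fAll => z; apply/sat_fImp => zF.
  have [x xa e] : F z by rewrite -eF.
  apply/sat_fEx; exists x; apply/sat_fEx; exists (g x); do 2?[apply/sat_fAnd; split] => //.
    exact: gf.
  by apply/sat_opair.
- apply/sat_fAll => x; apply/sat_fImp => xa; apply/sat_fEx; exists (g x).
  apply/sat_fAll => y.
  apply/sat_fIff; split.
    by move=> /sat_rel/FP[].
  by move=> e; apply/sat_rel/FP; split=> //; exact: e.
- apply/sat_fAll => y; apply/sat_fImp => yb; apply/sat_fEx.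
  have [x xa gx] := gs y yb; exists x; apply/sat_fAll => x'; apply/sat_fIff; split.
    move=> /sat_rel/FP[x'a /= e]; apply: gi; rewrite ?inE //; by rewrite gx.
  by move=> e; apply/sat_rel/FP; split=> /=; rewrite (e : x' = x).
Qed.
Lemma sat_branch T R v b : is_tree T R ->
  v 0 = b -> v 1 = T -> v 2 = R -> v 3 = levels T R ->
  sat setT v (f_branch 0 1 2 3) <-> branches T R b.
Proof.
move=> [RT _ _ _ _] vb vT vR vL; subst b T R; split.
  move=> /sat_fAnd[/sat_fAll h1 /sat_fAnd[/sat_fAll h2 /sat_fAnd[/sat_fAll h3 /sat_fAll h4]]]; split.
  - by move=> x; have /sat_fImp := h1 x; apply.
  - move=> x y xb yb; have /sat_fAll/(_ y)/sat_fImp h := h2 x.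
    by have /sat_fOr[/sat_rel|/sat_rel] := h (conj xb yb); [left|right].
  - move=> x y xb yx; have /sat_fAll/(_ y)/sat_fImp := h3 x; apply; split=> //.
    split; last by apply/sat_rel.
    by have [y' y'T [x' _ /opair_inj[<- _]]] := RT _ yx.
  - move=> a aw; have /sat_fImp h := h4 (set_of (level (v 1) (v 2) a)).
    have /h/sat_fEx[x []] : set_of (level (v 1) (v 2) a) ∈ v 3.
      by rewrite vL inVE elts_levels; exists a.
    by move=> xa xb; rewrite /= inVE elts_level in xa; exists x.
move=> [h1 h2 h3 h4]; do 3?[apply/sat_fAnd; split]; apply/sat_fAll => x.
- by apply/sat_fImp; apply: h1.
- apply/sat_fAll => y; apply/sat_fImp => -[xb yb].
  by apply/sat_fOr; case: (h2 x y xb yb); [left|right]; apply/sat_rel.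
- apply/sat_fAll => y; apply/sat_fImp => -[xb [_ /sat_rel]]; exact: h3.
- apply/sat_fImp => xL.
  have [a aw ax] : [set set_of (level (v 1) (v 2) a) | a in elts omega1] x.
    by rewrite -elts_levels -vL.
  apply/sat_fEx; have [y ya yb] := h4 a aw; exists y.
  by split; rewrite //= inVE -ax elts_level.
Qed.
Lemma forces_eq_check (P : Type) (le : P -> P -> Prop) : forcing_notion le ->
 forall x y p, forces_eq le (check_preset P x) (check_preset P y) p <-> eqset x y.
Proof.
move=> [_ rf tr]; elim=> A f IH [B g] p /=; split.
  move=> [h1 h2]; split.
    move=> a; have [r rp [b [_ [_ _ /IH]]]] := h1 a p p I (rf _) (rf _) _ (rf _).
    by exists b.
  move=> b; have [r rp [a [_ [_ _ /IH]]]] := h2 b p p I (rf _) (rf _) _ (rf _).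
  by exists a.
move=> [h1 h2]; split.
  move=> a p' q _ _ _ r _; have [b e] := h1 a; exists r => //.
  by exists b, r; split=> //; apply/IH.
move=> b p' q _ _ _ r _; have [a e] := h2 b; exists r => //.
by exists a, r; split=> //; apply/IH.
Qed.

(* Main.v *)
From HB Require Import structures.
From Pilot Require Import Defs.
From mathcomp Require Import all_boot.
From mathcomp Require Import all_classical.

Set Implicit Arguments.
Unset Strict Implicit.
Unset Printing Implicit Defensive.

Local Open Scope classical_set_scope.
Local Open Scope card_scope.
Local Open Scope quotient_scope.

(** The idea.  A generic for the sealing poset gives a function f from part of
    T to the natural numbers which increases weakly along the tree.  If b is a
    branch that the second factor adds, then f takes arbitrarily large values
    on b: a condition of the sealing poset can give any large value to a node
    of b which is far enough from everything that the condition mentions.  For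
    each k, look at the first node of b on which f is at least k.  These nodes
    are cofinal in b, so in the extension omega_1 has a cofinal
    omega-sequence.  Each of its proper initial segments is countable already
    in V, hence omega_1 is countable.

    Moving far enough away (lemma trapped, and the two lemmas after it).
    A condition mentions finitely many points in its domain and countably many
    branches in its countable models.  A new branch leaves each single point,
    because its part below any point is in V otherwise (in_branch_leaves); it
    may fail to leave countably many points at one level.  But then the levels
    at which it leaves these points one by one are themselves cofinal in
    omega_1, and the second factor alone collapses omega_1.  So both cases end
    in the same criterion, forces_equinumerous_of_cofinal.

    Adding the node (extend_condition).  Let t be the new node, m the highest
    meet of t with the domain, and y the least point of the domain above m.
    If m is not in the domain it must be added, with the value of y; by closure
    under branches this forces some branches of the models through m into the
    domain, hence their meets with t, y and each other, hence further branches
    of the models, and so on.  All these points lie above m and none of the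
    new ones lies above y, so giving all of them the value of y is consistent
    with the old condition.  The process ends since a model has at most one
    branch through a node outside it (finite_split_closure).

    Elementarity enters through two properties of a model N: N contains the
    predecessors of its nodes (model_downward), and consequently two different
    branches in N split at a node of N (model_split_branch).

    The last part is the passage from a cofinal sequence to a bijection in the
    forcing language.  A name is built from a relation that says which
    conditions decide which values, and its properties are read off from
    density statements (forces_bij). *)

(** * Natural numbers in V *)

Lemma inV_irr (x : V) : ~ x ∈ x.
Proof. by elim/inV_ind: x => x IH xx; exact: (IH x xx xx). Qed.

Lemma natV_inj : injective natV.
Proof.
have lt m n : (m < n)%N -> natV m ∈ natV n.
  elim: n => // n IH; rewrite ltnS leq_eqVlt inVE elts_natVS => /orP[/eqP ->|/IH]; first by right.
  by left.
by move=> m n e; case: (ltngtP m n) => // /lt; rewrite e => /inV_irr.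
Qed.

Lemma mem_omega x : x ∈ omega <-> exists n, x = natV n.
Proof. by rewrite inVE elts_omega; split=> [[n _ <-]|[n ->]]; exists n. Qed.

Lemma mem_natV x n : x ∈ natV n <-> exists2 k, (k < n)%N & x = natV k.
Proof.
elim: n => [|n IH]; first by rewrite inVE elts_emptyV; split=> [[]|[]].
rewrite inVE elts_natVS; split=> [[/IH[k kn ->]| ->]|[k]].
- by exists k => //; apply: ltnW.
- by exists n.
- by rewrite ltnS leq_eqVlt => /orP[/eqP -> ->|kn xk]; [right | left; apply/IH; exists k].
Qed.

Lemma natV_omega1 n : natV n ∈ omega1.
Proof.
have tr k : transitiveV (natV k).
  by move=> y /mem_natV[j jk ->] z /mem_natV[i ij ->]; apply/mem_natV; exists i => //; apply: ltn_trans jk.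
rewrite inVE elts_hartogs; split; first by split=> // y /mem_natV[k _ ->].
by apply: subset_card_le => x /mem_natV[k _ ->]; rewrite elts_omega; exists k.
Qed.

(** * The forcing relation and ordered pairs of names *)

Section Forcing.
Context (P : Type) (le : P -> P -> Prop).
Hypothesis fle : forcing_notion le.

Local Notation D := (dense_below le).
Local Notation "p ⊩ x ≡ y" := (forces_eq le x y p) (at level 70, x at level 60, y at level 60).
Local Notation "p ⊩ x ∊ y" := (forces_mem le x y p) (at level 70, x at level 60, y at level 60).

Let lexx p : le p p. Proof. by case: fle. Qed.
Let le_tr q p r : le p q -> le q r -> le p r.
Proof. by case: fle => _ _; apply. Qed.

Lemma dense_mono p q (A : set P) : le q p -> D p A -> D q A.
Proof. by move=> qp DA r rq; apply: DA; apply: le_tr qp. Qed.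

Lemma dense_ex p (A : set P) : D p A -> exists2 q, le q p & A q.
Proof. by apply. Qed.

Lemma dense_sub p (A B : set P) :
  (forall q, le q p -> A q -> B q) -> D p A -> D p B.
Proof.
by move=> AB DA q qp; have [r rq Ar] := DA q qp; exists r => //; apply: AB => //; apply: le_tr qp.
Qed.

Lemma dense_here p (A : set P) : (forall q, le q p -> A q) -> D p A.
Proof. by move=> h q qp; exists q => //; apply: h. Qed.

Lemma dense_join p (A : set P) : D p (fun q => D q A) -> D p A.
Proof.
move=> h q qp; have [r rq /(_ r (lexx r))[s sr As]] := h q qp.
by exists s => //; apply: le_tr rq.
Qed.

Lemma forces_eq_mono x y p q : le q p -> p ⊩ x ≡ y -> q ⊩ x ≡ y.
Proof.
case: x y => A f c [B g d] qp /= [h1 h2]; split=> a p' r ca rq rp'.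
  by apply: (h1 a p') => //; apply: le_tr qp.
by apply: (h2 a p') => //; apply: le_tr qp.
Qed.

(** Stability: what is forced densely is forced.  Together with monotonicity
    it lets the classical connectives, which are encoded with negations, be
    handled through their intuitionistic clauses below. *)
Lemma forces_eq_stable x y p : D p (fun q => q ⊩ x ≡ y) -> p ⊩ x ≡ y.
Proof.
case: x y => A f c [B g d] h /=; split=> a p' q ca qp qp' s sq.
  have [r rs [h1 _]] := h s (le_tr sq qp).
  have [r' r'r H] := h1 a p' r ca (lexx r) (le_tr rs (le_tr sq qp')) r (lexx r).
  by exists r' => //; apply: le_tr rs.
have [r rs [_ h2]] := h s (le_tr sq qp).
have [r' r'r H] := h2 a p' r ca (lexx r) (le_tr rs (le_tr sq qp')) r (lexx r).
by exists r' => //; apply: le_tr rs.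
Qed.

Lemma forces_eq_refl x p : p ⊩ x ≡ x.
Proof.
elim: x p => A f IH c p /=; split=> a p' q ca qp qp' r rq; exists r => //;
  by exists a, p'; split=> //; apply: le_tr qp'.
Qed.

Lemma forces_eq_sym x y p : p ⊩ x ≡ y -> p ⊩ y ≡ x.
Proof.
elim: x y p => A f IH c [B g d] p /= [h1 h2]; split=> a p' q ca qp qp'.
  apply: dense_sub (h2 a p' q ca qp qp') => r _ [b [q' [db rq' e]]].
  by exists b, q'; split=> //; apply: IH.
apply: dense_sub (h1 a p' q ca qp qp') => r _ [b [q' [db rq' e]]].
by exists b, q'; split=> //; apply: IH.
Qed.

Lemma forces_eq_trans y x z p : p ⊩ x ≡ y -> p ⊩ y ≡ z -> p ⊩ x ≡ z.
Proof.
elim: x y z p => A f IH c [B g d] [C h k] p /= [h1 h2] [h3 h4]; split=> a p' q ca qp qp'.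
  apply: dense_join; apply: dense_sub (h1 a p' q ca qp qp') => r rq [b [q' [db rq' e]]].
  have rp := le_tr rq qp.
  apply: dense_sub (h3 b q' r db rp rq') => s sr [b' [q'' [kb sq'' e']]].
  by exists b', q''; split=> //; apply: IH e'; apply: forces_eq_mono e.
apply: dense_join; apply: dense_sub (h4 a p' q ca qp qp') => r rq [b [q' [db rq' e]]].
have rp := le_tr rq qp.
apply: dense_sub (h2 b q' r db rp rq') => s sr [b' [q'' [kb sq'' e']]].
by exists b', q''; split=> //; apply: IH e' _; apply: forces_eq_mono e.
Qed.

Lemma forces_mem_mono x y p q : le q p -> p ⊩ x ∊ y -> q ⊩ x ∊ y.
Proof. by case: y => B g d qp; apply: dense_mono. Qed.

Lemma forces_mem_stable x y p : D p (fun q => q ⊩ x ∊ y) -> p ⊩ x ∊ y.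
Proof. by case: y => B g d; apply: dense_join. Qed.

Lemma forces_mem_eql x x' y p : p ⊩ x ≡ x' -> p ⊩ x ∊ y -> p ⊩ x' ∊ y.
Proof.
case: y => B g d e; apply: dense_sub => q qp [b [q' [db qq' e']]].
by exists b, q'; split=> //; apply: forces_eq_trans e'; apply: forces_eq_sym; apply: forces_eq_mono e.
Qed.

Lemma forces_mem_eqr x y y' p : p ⊩ y ≡ y' -> p ⊩ x ∊ y -> p ⊩ x ∊ y'.
Proof.
case: y y' => B g d [C h k] [h1 _] m.
apply: dense_join; apply: dense_sub m => q qp [b [q' [db qq' e]]].
apply: dense_sub (h1 b q' q db qp qq') => r rq [c [q'' [kc rq'' e']]].
by exists c, q''; split=> //; apply: forces_eq_trans e'; apply: forces_eq_mono e.
Qed.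

Lemma forces_eq_ext x y p :
  (forall z q, le q p -> (q ⊩ z ∊ x <-> q ⊩ z ∊ y)) -> p ⊩ x ≡ y.
Proof.
case: x y => A f c [B g d] h /=; split=> a p' q ca qp qp'.
  apply: (iffLR (h (f a) q qp)); apply: dense_here => r rq.
  by exists a, p'; split=> //; [apply: le_tr qp' | apply: forces_eq_refl].
have : q ⊩ g a ∊ Name f c.
  apply: (iffRL (h (g a) q qp)); apply: dense_here => r rq.
  by exists a, p'; split=> //; [apply: le_tr qp' | apply: forces_eq_refl].
apply: dense_sub => r rq [b [q' [cb rq' e]]].
by exists b, q'; split=> //; apply: forces_eq_sym.
Qed.

Lemma forces_mono phi v p q : le q p -> forces le p v phi -> forces le q v phi.
Proof.
elim: phi v p q => [i j|i j|a IH|a IHa b IHb|a IH] v p q qp /=.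
- exact: forces_mem_mono.
- exact: forces_eq_mono.
- by move=> h r rq; apply: h; apply: le_tr qp.
- by move=> [ha hb]; split; [apply: IHa ha | apply: IHb hb].
- by move=> h x; apply: IH (h x).
Qed.

Lemma forces_stable phi v p : D p (fun q => forces le q v phi) -> forces le p v phi.
Proof.
elim: phi v p => [i j|i j|a IH|a IHa b IHb|a IH] v p h /=.
- exact: forces_mem_stable.
- exact: forces_eq_stable.
- move=> q qp fa; have [r rq /(_ r (lexx r))] := h q qp; apply.
  exact: forces_mono fa.
- by split; [apply: IHa | apply: IHb]; apply: dense_sub h => q _ [].
- by move=> x; apply: IH; apply: dense_sub h => q _ /(_ x).
Qed.

Lemma forces_and p v a b :
  forces le p v (fAnd a b) <-> forces le p v a /\ forces le p v b.
Proof. by []. Qed.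

Lemma forces_all p v a :
  forces le p v (fAll a) <-> forall x, forces le p (scons x v) a.
Proof. by []. Qed.

Lemma forces_imp p v a b : forces le p v (fImp a b) <->
  forall q, le q p -> forces le q v a -> forces le q v b.
Proof.
split=> [h q qp fa|h q qp [fa nb]]; last exact: nb (lexx q) (h q qp fa).
apply: forces_stable => r rq; apply: contrapT => n.
apply: (h r (le_tr rq qp)); split; first exact: forces_mono fa.
by move=> s sr fb; apply: n; exists s.
Qed.

Lemma forces_or p v a b : forces le p v (fOr a b) <->
  D p (fun q => forces le q v a \/ forces le q v b).
Proof.
split=> [h q qp|h q qp [na nb]].
  apply: contrapT => n; apply: (h q qp).
  by split=> r rq f; apply: n; exists r; [|left| |right].
by have [r rq [/na|/nb]] := h q qp; apply.
Qed.

Lemma forces_iff p v a b : forces le p v (fIff a b) <->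
  forall q, le q p -> (forces le q v a <-> forces le q v b).
Proof.
split=> [[/forces_imp h1 /forces_imp h2] q qp|h].
  by split; [apply: h1 | apply: h2].
by split; apply/(forces_imp p v) => q qp; apply h.
Qed.

Lemma forces_ex p v a : forces le p v (fEx a) <->
  D p (fun q => exists x, forces le q (scons x v) a).
Proof.
split=> [h q qp|h q qp n]; last first.
  by have [r rq [x f]] := h q qp; exact: (n x r rq f).
apply: contrapT => n; apply: (h q qp) => x r rq f; apply: n.
by exists r => //; exists x.
Qed.

(** Pairs of names are again names, rather than check names of
    pairs, since the quantifiers in f_bij range over arbitrary names. *)
Definition upairN (x y : PName P) : PName P :=
  Name (fun i : bool => if i then x else y) (fun _ _ => True).

Definition opairN (x y : PName P) : PName P := upairN (upairN x x) (upairN x y).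

Lemma forces_mem_upairN z x y p :
  p ⊩ z ∊ upairN x y <-> D p (fun q => q ⊩ z ≡ x \/ q ⊩ z ≡ y).
Proof.
split; apply: dense_sub => q _.
  by case=> -[] [q' [_ _ e]]; [left | right].
by case=> e; [exists true, q | exists false, q]; split.
Qed.

Lemma forces_mem_upairNl x y p : p ⊩ x ∊ upairN x y.
Proof. by apply/forces_mem_upairN; apply: dense_here => q _; left; apply: forces_eq_refl. Qed.

Lemma forces_mem_upairNr x y p : p ⊩ y ∊ upairN x y.
Proof. by apply/forces_mem_upairN; apply: dense_here => q _; right; apply: forces_eq_refl. Qed.

Lemma forces_mem_upairNN z x p : p ⊩ z ∊ upairN x x <-> p ⊩ z ≡ x.
Proof.
split=> [/forces_mem_upairN h|e]; first by apply: forces_eq_stable; apply: dense_sub h => q _ [].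
by apply/forces_mem_upairN; apply: dense_here => q qp; left; apply: forces_eq_mono e.
Qed.

Lemma forces_eq_upairN x y x' y' p : p ⊩ x ≡ x' -> p ⊩ y ≡ y' ->
  p ⊩ upairN x y ≡ upairN x' y'.
Proof.
move=> ex ey; apply: forces_eq_ext => z q qp; split=> /forces_mem_upairN h; apply/forces_mem_upairN;
  apply: dense_sub h => r rq; have rp := le_tr rq qp; case=> e; [left|right|left|right];
  apply: forces_eq_trans e _; try exact: forces_eq_mono ex; try exact: forces_eq_mono ey;
  apply: forces_eq_sym; try exact: forces_eq_mono ex; exact: forces_eq_mono ey.
Qed.

Lemma forces_eq_opairN x y x' y' p : p ⊩ x ≡ x' -> p ⊩ y ≡ y' ->
  p ⊩ opairN x y ≡ opairN x' y'.
Proof. by move=> ex ey; do !apply: forces_eq_upairN. Qed.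

Lemma forces_upairN1_inj x u v p : p ⊩ upairN x x ≡ upairN u v -> p ⊩ u ≡ x /\ p ⊩ v ≡ x.
Proof.
move=> /forces_eq_sym e; split; apply/forces_mem_upairNN; apply: forces_mem_eqr e _.
  exact: forces_mem_upairNl.
exact: forces_mem_upairNr.
Qed.

Lemma forces_opairN_inj x y x' y' p : p ⊩ opairN x y ≡ opairN x' y' ->
  p ⊩ x ≡ x' /\ p ⊩ y ≡ y'.
Proof.
move=> e.
have exx : p ⊩ x ≡ x'.
  have /forces_mem_upairN h := forces_mem_eqr e (@forces_mem_upairNl (upairN x x) (upairN x y) p).
  apply: forces_eq_stable; apply: dense_sub h => q _.
  by case=> /forces_upairN1_inj[/forces_eq_sym].
split=> //.
have h1 : p ⊩ upairN x y ∊ opairN x' y' by apply: forces_mem_eqr e _; apply: forces_mem_upairNr.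
have h2 : p ⊩ upairN x' y' ∊ opairN x y.
  by apply: forces_mem_eqr (forces_eq_sym e) _; apply: forces_mem_upairNr.
apply: forces_eq_stable; apply: dense_join.
move/forces_mem_upairN: h1; apply: dense_sub => q qp h.
have {}exx : q ⊩ x ≡ x' by apply: forces_eq_mono exx.
have {}h2 : q ⊩ y' ∊ upairN x y.
  move: h2 => /forces_mem_upairN/(dense_mono qp) h2.
  apply: forces_mem_stable; apply: dense_sub h2 => r _ [] e2.
    apply: forces_mem_eql (@forces_mem_upairNl x y r).
    by case: (forces_upairN1_inj (forces_eq_sym e2)) => _ /forces_eq_sym.
  exact: forces_mem_eqr e2 (@forces_mem_upairNr _ _ _).
move/forces_mem_upairN: h2 => h2.
have {h} [yx|{}h] : q ⊩ y ≡ x \/ q ⊩ y ∊ upairN x' y'.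
- case: h => [/forces_eq_sym/forces_upairN1_inj[_ yx]|e2]; last first.
    by right; apply: forces_mem_eqr e2 _; apply: forces_mem_upairNr.
  by left; apply: forces_eq_trans (forces_eq_sym exx).
- apply: dense_sub h2 => r rq [/forces_eq_sym e2|/forces_eq_sym //].
  by apply: forces_eq_trans e2; apply: forces_eq_mono yx.
move/forces_mem_upairN: h => h; apply: dense_join; apply: dense_sub h => r rq [e2|e2]; last first.
  by apply: dense_here => s sr; apply: forces_eq_mono e2.
apply: dense_sub (dense_mono rq h2) => s sr [e3|/forces_eq_sym //].
apply: forces_eq_trans (forces_eq_mono sr e2) _; apply: forces_eq_trans (forces_eq_sym e3).
by apply: forces_eq_sym; apply: forces_eq_mono exx; apply: le_tr rq.
Qed.

Lemma forces_upair p v z x y :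
  forces le p v (f_upair z x y) <-> p ⊩ v z ≡ upairN (v x) (v y).
Proof.
split=> [/forces_all h|e].
  apply: forces_eq_ext => w q qp; have /forces_iff/(_ q qp) hw := h w.
  split; first by move/(iffLR hw)/forces_or => h'; apply/forces_mem_upairN.
  by move/forces_mem_upairN => h'; apply: (iffRL hw); apply/forces_or.
apply/forces_all => w; apply/forces_iff => q qp; have eq := forces_eq_mono qp e.
split=> [h|/forces_or h].
  by apply/forces_or/forces_mem_upairN; apply: forces_mem_eqr eq h.
by apply: forces_mem_eqr (forces_eq_sym eq) _; apply/forces_mem_upairN.
Qed.

Lemma forces_opair p v z x y :
  forces le p v (f_opair z x y) <-> p ⊩ v z ≡ opairN (v x) (v y).
Proof.
split=> [/forces_ex h|e].
  apply: forces_eq_stable; apply: dense_join; apply: dense_sub h => q _ [s /forces_ex].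
  apply: dense_sub => r _ [t /forces_and[/forces_upair es /forces_and[/forces_upair et /forces_upair ez]]].
  by apply: forces_eq_trans ez _; apply: forces_eq_upairN.
apply/forces_ex; apply: dense_here => q qp; exists (upairN (v x) (v x)).
apply/forces_ex; apply: dense_here => r rq; exists (upairN (v x) (v y)).
do 2?[apply/forces_and; split]; apply/forces_upair; try exact: forces_eq_refl.
by apply: forces_eq_mono e; apply: le_tr qp.
Qed.

Lemma forces_rel p v r x y :
  forces le p v (f_rel r x y) <-> p ⊩ opairN (v x) (v y) ∊ v r.
Proof.
split=> [/forces_ex h|h].
  apply: forces_mem_stable; apply: dense_sub h => q _ [z /forces_and[/forces_opair e m]].
  exact: forces_mem_eql e m.
apply/forces_ex; apply: dense_here => q qp; exists (opairN (v x) (v y)).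
apply/forces_and; split; first by apply/forces_opair; apply: forces_eq_refl.
exact: forces_mem_mono h.
Qed.

Lemma forces_eq_checkE x y p : p ⊩ check P x ≡ check P y <-> x = y.
Proof.
rewrite /check forces_eq_check // -pi_eqset !reprK; split=> //.
Qed.

Lemma forces_mem_check x y p :
  p ⊩ x ∊ check P y <-> D p (fun q => exists2 u, u ∈ y & q ⊩ x ≡ check P u).
Proof.
have yE u : u ∈ y <-> u ∈ \pi_V (repr y) by rewrite reprK.
move: yE; rewrite /check; case: (repr y) => A f yE; split; apply: dense_sub => q _.
  move=> [a [q' [_ _ e]]]; exists (\pi_V (f a)); first by apply/yE/inV_pi; exists a.
  by apply: forces_eq_trans e _; apply/forces_eq_check => //; apply/pi_eqset; rewrite reprK.
move=> [u /yE/inV_pi[a au] e]; exists a, q; split=> //.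
by apply: forces_eq_trans e _; apply/forces_eq_check => //; apply/pi_eqset; rewrite reprK.
Qed.

Lemma forces_mem_checkE x y p : p ⊩ check P x ∊ check P y <-> x ∈ y.
Proof.
rewrite forces_mem_check; split=> [/dense_ex[q _ [u uy /forces_eq_checkE -> //]]|xy].
by apply: dense_here => q _; exists x => //; apply: forces_eq_refl.
Qed.

Lemma forces_upairN_check x y p : p ⊩ upairN (check P x) (check P y) ≡ check P (upair x y).
Proof.
have uE u : u ∈ upair x y <-> u = x \/ u = y by rewrite inVE elts_upair.
apply: forces_eq_ext => z q _; rewrite forces_mem_upairN forces_mem_check; split; apply: dense_sub => r _.
  by case=> e; [exists x | exists y] => //; apply/uE; [left | right].
by case=> u /uE[] ->; [left | right].
Qed.

Lemma forces_opairN_check x y p : p ⊩ opairN (check P x) (check P y) ≡ check P (opair x y).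
Proof. by apply: forces_eq_trans (forces_upairN_check _ _ _); apply: forces_eq_upairN; apply: forces_upairN_check. Qed.

Lemma forces_opairN_mem_check x y r p :
  p ⊩ opairN (check P x) (check P y) ∊ check P r <-> opair x y ∈ r.
Proof.
have e := forces_opairN_check x y p.
split=> [/(forces_mem_eql e)/forces_mem_checkE //|h].
by apply: forces_mem_eql (forces_eq_sym e) _; apply/forces_mem_checkE.
Qed.

(** The name of the set of pairs (a, n), each put in by the conditions r with
    J a n r. *)
Definition bijN (J : V -> nat -> P -> Prop) : PName P :=
  Name (fun an : Index omega1 * nat =>
          opairN (check P (elt an.1)) (check P (natV an.2)))
       (fun an r => J (elt an.1) an.2 r).

Lemma forces_mem_bijN J x y p : (forall a n q r, le r q -> J a n q -> J a n r) ->
  p ⊩ opairN x y ∊ bijN J <-> D p (fun q => exists a n,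
    [/\ a ∈ omega1, J a n q, q ⊩ x ≡ check P a & q ⊩ y ≡ check P (natV n)]).
Proof.
move=> Jo; split; apply: dense_sub => q _.
  move=> [[i n] [q' [/= Jq' qq' /forces_opairN_inj[ex ey]]]]; exists (elt i), n.
  by split=> //; [exists i | exact: Jo Jq'].
move=> [_ [n [[i <-] Jq ex ey]]]; exists (i, n), q; split=> //.
exact: forces_eq_opairN.
Qed.

(** The pairs in J are those which a condition decides.  Functionality and
    injectivity are needed only for what one condition decides, because two
    conditions in a generic filter have a common extension and J is open. *)
Lemma forces_bij (J : V -> nat -> P -> Prop) (v : nat -> PName P) p :
  (forall a n q r, le r q -> J a n q -> J a n r) ->
  (forall a n n' q, le q p -> J a n q -> J a n' q -> n = n') ->
  (forall a a' n q, le q p -> J a n q -> J a' n q -> a = a') ->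
  (forall a, a ∈ omega1 -> D p (fun q => exists n, J a n q)) ->
  (forall n, D p (fun q => exists2 a, a ∈ omega1 & J a n q)) ->
  v 0 = bijN J -> v 1 = check P omega1 -> v 2 = check P omega ->
  forces le p v (f_bij 0 1 2).
Proof.
move=> Jo Jfun Jinj Jtot Jsur v0 v1 v2; do 2?[apply/forces_and; split].
- apply/forces_all => z; apply/forces_imp => q qp zF; rewrite /= v0 in zF.
  apply/forces_ex.
  apply: dense_sub zF => r rq [[i n] [q' [Jr rq' e]]].
  exists (check P (elt i)); apply/forces_ex.
  apply: dense_here => s sr.
  exists (check P (natV n)); do 2?[apply/forces_and; split].
  + by rewrite /= v1; apply/forces_mem_checkE; exists i.
  + by rewrite /= v2; apply/forces_mem_checkE/mem_omega; exists n.
  + by apply/forces_opair; apply: forces_eq_mono e.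
- apply/forces_all => x; apply/forces_imp => q qp xw; rewrite /= v1 in xw; move/forces_mem_check: xw => xw.
  apply/forces_ex; apply: dense_join.
  apply: dense_sub xw => r rq [a aw ex]; have rp := le_tr rq qp.
  apply: dense_sub (dense_mono rp (Jtot a aw)) => s sr [n Jn]; have sp := le_tr sr rp.
  exists (check P (natV n)); apply/forces_all => y; apply/forces_iff => t ts.
  have tp := le_tr ts sp; have ext := forces_eq_mono (le_tr ts sr) ex.
  rewrite forces_rel /= v0 forces_mem_bijN //; split=> [h|e].
    apply: forces_eq_stable; apply: dense_sub h => u ut [a' [n' [_ Jn' e1 e2]]].
    have e3 : u ⊩ check P a ≡ check P a'.
      by apply: forces_eq_trans e1; apply: forces_eq_sym; apply: forces_eq_mono ext.
    move/forces_eq_checkE: e3 => e3; rewrite -e3 in Jn'.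
    have us := le_tr ut ts.
    by rewrite (Jfun a n n' u (le_tr us sp) (Jo _ _ _ _ us Jn) Jn').
  apply: dense_here => u ut; exists a, n; split=> //.
  + by apply: Jo Jn; apply: le_tr ts.
  + exact: forces_eq_mono ext.
  + exact: forces_eq_mono e.
- apply/forces_all => y; apply/forces_imp => q qp yw; rewrite /= v2 in yw; move/forces_mem_check: yw => yw.
  apply/forces_ex; apply: dense_join.
  apply: dense_sub yw => r rq [_ /mem_omega[n ->] ey]; have rp := le_tr rq qp.
  apply: dense_sub (dense_mono rp (Jsur n)) => s sr [a aw Jn]; have sp := le_tr sr rp.
  exists (check P a); apply/forces_all => x; apply/forces_iff => t ts.
  have tp := le_tr ts sp; have eyt := forces_eq_mono (le_tr ts sr) ey.
  rewrite forces_rel /= v0 forces_mem_bijN //; split=> [h|e].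
    apply: forces_eq_stable; apply: dense_sub h => u ut [a' [n' [_ Jn' e1 e2]]].
    have e3 : u ⊩ check P (natV n) ≡ check P (natV n').
      by apply: forces_eq_trans e2; apply: forces_eq_sym; apply: forces_eq_mono eyt.
    move/forces_eq_checkE/natV_inj: e3 => e3; rewrite -e3 in Jn'.
    have us := le_tr ut ts.
    by rewrite (Jinj a a' n u (le_tr us sp) (Jo _ _ _ _ us Jn) Jn').
  apply: dense_here => u ut; exists a, n; split=> //.
  + by apply: Jo Jn; apply: le_tr ts.
  + exact: forces_eq_mono e.
  + exact: forces_eq_mono eyt.
Qed.

End Forcing.

(** * Finite closures in a tree with meets *)

(** The order is reflexive exactly on the points that count, so le x x plays
    the role of a membership hypothesis. *)
Section MeetTree.
Context (X : choiceType) (le : X -> X -> Prop) (meet : X -> X -> X).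
Hypothesis le_tr : forall y x z, le x y -> le y z -> le x z.
Hypothesis le_anti : forall x y, le x y -> le y x -> x = y.
Hypothesis le_lin : forall x y z, le x z -> le y z -> le x y \/ le y x.
Hypothesis leI : forall z x y, le z (meet x y) <-> le z x /\ le z y.
Hypothesis le_meet : forall x y, le x x -> le y y -> le (meet x y) (meet x y).
Hypothesis le_dom : forall x y, le x y -> le x x /\ le y y.

Lemma meet_lel x y : le x x -> le y y -> le (meet x y) x.
Proof. by move=> xx yy; have /leI[] := le_meet xx yy. Qed.

Lemma meet_ler x y : le x x -> le y y -> le (meet x y) y.
Proof. by move=> xx yy; have /leI[] := le_meet xx yy. Qed.

Lemma meetE z x y : le z z -> (forall w, le w z <-> le w x /\ le w y) ->
  le x x -> le y y -> z = meet x y.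
Proof.
move=> zz h xx yy; apply: le_anti; first by apply/leI/h.
by apply/h; split; [apply: meet_lel | apply: meet_ler].
Qed.

Lemma meetxx x : le x x -> meet x x = x.
Proof. by move=> xx; apply/esym/meetE => // w; split=> [//|[]]. Qed.

Lemma meetC x y : le x x -> le y y -> meet x y = meet y x.
Proof.
move=> xx yy; apply: meetE => //; first exact: le_meet.
by move=> w; rewrite leI; tauto.
Qed.

Lemma meet_l x y : le x y -> meet x y = x.
Proof.
move=> xy; have [xx yy] := le_dom xy; apply/esym/meetE => // w.
by split=> [wx|[]//]; split=> //; apply: le_tr xy.
Qed.

(** The basic tree argument: if d branches off w before z, and a is another
    point above z, then a branches off w at the same place. *)
Lemma meet_replace d w z a : le w w -> le z d -> ~ le z (meet d w) -> le z a ->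
  meet a w = meet d w.
Proof.
move=> ww zd nz za; have [_ dd] := le_dom zd; have [_ aa] := le_dom za.
have key u v : le u u -> le z u -> le z v -> ~ le z (meet u w) ->
    le (meet u w) (meet v w).
  move=> uu zu zv n; apply/leI; split; last exact: meet_ler.
  by case: (le_lin (meet_lel uu ww) zu) => [h|//]; apply: le_tr zv.
apply: le_anti; apply: key => // /leI[_ zw]; apply: nz; exact/leI.
Qed.

Definition pair_meets (G : set X) : set X := [set meet a b | a in G & b in G].

Lemma meets_incl (G : set X) x : le x x -> G x -> pair_meets G x.
Proof. by move=> xx Gx; exists x => //; exists x => //; apply: meetxx. Qed.

Lemma meets_meet (G : set X) x y : G `<=` [set x | le x x] ->
  pair_meets G x -> pair_meets G y -> pair_meets G (meet x y).
Proof.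
move=> Gle.
have step z c : pair_meets G z -> G c -> pair_meets G (meet z c).
  move=> [a Ga [b Gb <-]] Gc.
  have [/= aa bb cc] : [/\ le a a, le b b & le c c] by split; apply: Gle.
  have [h|h] := pselect (le (meet a b) (meet a c)).
    exists a => //; exists b => //; apply: meetE => //.
    - exact: le_meet.
    - move=> w; split=> [wab|[]//]; split=> //.
      by have /leI[] := le_tr wab h.
    - exact: le_meet.
  exists a => //; exists c => //; apply: esym; apply: meet_replace h _ => //.
    exact: meet_lel.
  exact: le_meet.
move=> Gx [c Gc [d Gd <-]].
have [/= cc dd] : [/\ le c c & le d d] by split; apply: Gle.
have xx : le x x.
  by case: Gx => [a Ga [b Gb <-]]; apply: le_meet; apply: Gle.
have -> : meet x (meet c d) = meet (meet x c) d.
  apply: meetE => //; first by do !apply: le_meet.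
    by move=> w; rewrite !leI; tauto.
  exact: le_meet.
by apply: (step) => //; apply: (step).
Qed.

Context (M : eqType) (out Br : M -> set X).
Hypothesis Br_le : forall N c, Br N c -> le c c.
Hypothesis Br_uniq : forall N z c c', out N z -> Br N c -> Br N c' ->
  le z c -> le z c' -> c = c'.

(** In the application N is a model, out N its complement and Br N its
    branches: once a model's branch c passes through a meet outside the model,
    closure under branches requires c. *)
Inductive split_closure (s : seq M) (G : set X) : X -> Prop :=
| split_closure_base x : G x -> split_closure s G x
| split_closure_step a b N c : split_closure s G a -> split_closure s G b -> N \in s -> out N (meet a b) ->
    Br N c -> le (meet a b) c -> split_closure s G c.

Lemma split_closure_le (s : seq M) (G : set X) : G `<=` [set x | le x x] ->
  split_closure s G `<=` [set x | le x x].
Proof. by move=> Gle x [y /Gle//|a b N c _ _ _ _ /Br_le]. Qed.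

(** Induction on the list of models.  Let C1 be the closure under the models in
    s and X1 the branches of N through meets of C1 outside N, at most one for
    each meet.  Closing C1 and X1 under s only adds points above meets of C1
    outside N, so any further meet, if not one of C1 already, is above such a
    meet z; a branch of N through it is the branch of N through z and was put
    in with X1.  One more round per model is therefore enough. *)
Lemma finite_split_closure (s : seq M) (G : set X) : G `<=` [set x | le x x] ->
  finite_set G -> finite_set (split_closure s G).
Proof.
elim: s G => [|N s IH] G Gle Gfin.
  by apply: sub_finite_set Gfin => x; elim=> // ? ? ? ? _ _ _ _; rewrite in_nil.
pose C1 := split_closure s G.
have C1le : C1 `<=` [set x | le x x] by apply: split_closure_le.
have C1fin : finite_set C1 by apply: IH.
pose X1 := [set c | exists z, [/\ pair_meets C1 z, out N z, Br N c & le z c]].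
have X1le : X1 `<=` [set x | le x x] by move=> c [z [_ _ /Br_le]].
have X1fin : finite_set X1.
  pose g z := xget z [set c | Br N c /\ le z c].
  apply: (@sub_finite_set _ _ [set g (meet a b) | a in C1 & b in C1]).
    move=> c [_ [[a C1a [b C1b <-]] oz Bc zc]]; exists a => //; exists b => //.
    by apply: xget_unique => // c' [Bc' zc']; apply: (Br_uniq oz).
  exact: finite_image2.
have C2le : C1 `|` X1 `<=` [set x | le x x] by move=> x [/C1le|/X1le].
pose good d := C1 d \/ exists z, [/\ pair_meets C1 z, out N z & le z d].
have good_pair a b : le a a -> le b b -> good a -> good b ->
    pair_meets C1 (meet a b) \/ exists z, [/\ pair_meets C1 z, out N z & le z (meet a b)].
  have half a' b' : le a' a' -> le b' b' -> good a' ->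
     (exists2 c, C1 c & meet c b' = meet a' b') \/
     exists z, [/\ pair_meets C1 z, out N z & le z (meet a' b')].
    move=> aa bb [C1a|[z [[c C1c [d C1d zE]] oz za]]]; first by left; exists a'.
    have [h|h] := pselect (le z (meet a' b')).
      by right; exists z; split=> //; exists c => //; exists d.
    left; exists c => //; apply: (meet_replace bb za h).
    by rewrite -zE; apply: meet_lel; apply: C1le.
  move=> aa bb /(half a b aa bb)[[c C1c <-] gb|? _]; last by right.
  have cc := C1le c C1c; rewrite meetC //.
  have [[d C1d <-]|?] := half b c bb cc gb; last by right.
  by left; exists d => //; exists c.
have closure_good d : split_closure s (C1 `|` X1) d -> good d.
  elim=> [x [|[z [mz oz _ zx]]]|a b N' c cla ga clb gb sN' oN' Bc zc]; first by left.
    by right; exists z.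
  have [mab|[z [mz oz zab]]] := good_pair a b (split_closure_le C2le cla) (split_closure_le C2le clb) ga gb.
    left; case: mab => a' C1a' [b' C1b' e]; rewrite -e in oN' zc.
    exact: split_closure_step oN' Bc zc.
  by right; exists z; split=> //; apply: le_tr zc.
apply: (@sub_finite_set _ _ (split_closure s (C1 `|` X1))); last first.
  by apply: IH => //; rewrite finite_setU.
move=> x; elim=> {x} [x Gx|a b N' c _ ha _ hb].
  by apply: split_closure_base; left; apply: split_closure_base.
rewrite inE => /orP[/eqP ->|sN'] oN' Bc zc; last exact: split_closure_step oN' Bc zc.
apply: split_closure_base; right.
have [mab|[z [mz oz zab]]] :=
    good_pair a b (split_closure_le C2le ha) (split_closure_le C2le hb) (closure_good _ ha) (closure_good _ hb).
  by exists (meet a b).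
by exists z; split=> //; apply: le_tr zc.
Qed.

End MeetTree.

(** * Points of the tree and one-node extensions *)

HB.instance Definition _ := gen_eqMixin Defs.point.
HB.instance Definition _ := gen_choiceMixin Defs.point.

Lemma finite_directed (X : choiceType) (r : X -> X -> Prop) (A : set X) :
  (forall b a c, r a b -> r b c -> r a c) -> finite_set A -> A !=set0 ->
  (forall a b, A a -> A b -> exists c, [/\ A c, r c a & r c b]) ->
  exists2 c, A c & forall a, A a -> r c a.
Proof.
move=> rtr /finite_seqP[s As] [a0 Aa0] dir.
suff [c Ac cP] : exists2 c, A c & forall a, a \in s -> r c a.
  by exists c => // a; rewrite As => /cP.
have: forall a, a \in s -> A a by move=> a; rewrite As.
elim: s {As} => [|b s IH] sA; first by exists a0.
have [|c Ac cP] := IH; first by move=> a sa; apply: sA; rewrite inE sa orbT.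
have [|d [Ad dc db]] := dir c b Ac; first by apply: sA; rewrite inE eqxx.
exists d => // a; rewrite inE => /orP[/eqP -> //|/cP]; exact: rtr.
Qed.

Section Points.
Context (T R : V).
Hypothesis hT : is_tree T R.
Hypothesis hmeets : has_meets T R.

Local Notation pt := (is_point T R).
Local Notation lp := (lept R).

Definition ple (x y : Defs.point) : Prop := [/\ pt x, pt y & lp x y].

(** The default value Node T is not a point, because T is not an element of
    itself; so pleI holds without hypotheses on x and y. *)
Definition pmeet (x y : Defs.point) : Defs.point :=
  xget (Node T) [set z | [/\ pt x, pt y & is_meet T R x y z]].

Lemma leT_dom s t : leT R s t -> s ∈ T /\ t ∈ T.
Proof. by case: hT => RT _ _ _ _ /RT[a aT [b bT /opair_inj[<- <-]]]. Qed.

Lemma leT_refl s : s ∈ T -> leT R s s.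
Proof. by case: hT => _ h _ _ _; apply: h. Qed.

Lemma leT_anti s t : leT R s t -> leT R t s -> s = t.
Proof. by case: hT => _ _ h _ _; apply: h. Qed.

Lemma leT_tr t s u : leT R s t -> leT R t u -> leT R s u.
Proof. by case: hT => _ _ _ h _; apply: h. Qed.

Lemma leT_lin s t u : leT R s u -> leT R t u -> leT R s t \/ leT R t s.
Proof.
move=> su tu; have [sT uT] := leT_dom su.
have [->|sn] := pselect (s = u); first by right.
have [->|tn] := pselect (t = u); first by left.
case: hT => _ _ _ _ /(_ u uT [set s; t])[].
- by move=> _ [->|->].
- by exists s; left.
- by move=> m [->|->] h; [left; apply: h; right | right; apply: h; left].
Qed.

Lemma branch_dom b s : branches T R b -> s ∈ b -> s ∈ T.
Proof. by move=> [h _ _ _]; apply: h. Qed.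

Lemma branch_down b s t : branches T R b -> t ∈ b -> leT R s t -> s ∈ b.
Proof. by move=> [_ _ h _] tb st; apply: h tb st. Qed.

Lemma ple_refl x : pt x -> ple x x.
Proof. by move=> px; split=> //; case: x px => //= t; apply: leT_refl. Qed.

Lemma ple_dom x y : ple x y -> ple x x /\ ple y y.
Proof. by move=> [px py _]; split; apply: ple_refl. Qed.

Lemma ple_tr y x z : ple x y -> ple y z -> ple x z.
Proof.
move=> [px py xy] [_ pz yz]; split=> //.
case: x y z px py pz xy yz => [s|b] [t|c] [u|d] //= px py pz.
- exact: leT_tr.
- by move=> st td; apply: branch_down st.
- by move=> sc <-.
- by move=> ->.
Qed.

Lemma ple_anti x y : ple x y -> ple y x -> x = y.
Proof.
move=> [_ _ xy] [_ _ yx]; case: x y xy yx => [s|b] [t|c] //=.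
  by move=> st ts; rewrite (leT_anti st ts).
by move=> ->.
Qed.

Lemma ple_lin x y z : ple x z -> ple y z -> ple x y \/ ple y x.
Proof.
move=> [px pz xz] [py _ yz].
suff : lp x y \/ lp y x by case=> h; [left|right]; split.
case: x y z px py pz xz yz => [s|b] [t|c] [u|d] //= px py pz.
- exact: leT_lin.
- by case: pz => _ h _ _ sd td; apply: h.
- by move=> sd ->; left.
- by move=> -> td; right.
- by move=> -> ->; left.
Qed.

Lemma pmeetP x y : pt x -> pt y -> is_meet T R x y (pmeet x y).
Proof.
move=> px py; have [z zm] := hmeets px py.
have : [set z | [/\ pt x, pt y & is_meet T R x y z]] (pmeet x y).
  by apply: xgetPex; exists z.
by case.
Qed.

Lemma pleI z x y : ple z (pmeet x y) <-> ple z x /\ ple z y.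
Proof.
split.
  have [[px py]|n] := pselect (pt x /\ pt y).
    have [pm mx my _] := pmeetP px py.
    by move=> h; split; apply: ple_tr h _; split.
  have -> : pmeet x y = Node T.
    by apply: xgetPN => w [px py _]; apply: n.
  by move=> [_ /inV_irr].
move=> [[pz px zx] [_ py zy]]; have [pm mx my h] := pmeetP px py.
by split=> //; apply: h.
Qed.

Lemma ple_meet x y : ple x x -> ple y y -> ple (pmeet x y) (pmeet x y).
Proof. by move=> [px _ _] [py _ _]; have [pm _ _ _] := pmeetP px py; apply: ple_refl. Qed.

Lemma is_meetE x y z : pt x -> pt y -> is_meet T R x y z -> z = pmeet x y.
Proof.
move=> px py [pz zx zy h]; apply: (meetE ple_anti pleI ple_meet); try exact: ple_refl.
move=> w; split=> [wz|[[pw _ wx] [_ _ wy]]].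
  by split; apply: ple_tr wz _; split.
by split=> //; apply: h.
Qed.

Section Extend.
Context (SS TT : set V) (p : condition).
Hypothesis hp : sealing_condition T R SS TT p.
Hypothesis rT : exists r, is_root T R r.
Hypothesis model_down : forall N s t, N \in cmodels p -> t ∈ N -> leT R s t -> s ∈ N.
Hypothesis model_split : forall N s b c, N \in cmodels p -> s ∈ T -> ~ s ∈ N ->
  b ∈ N -> c ∈ N -> branches T R b -> branches T R c -> s ∈ b -> s ∈ c -> b = c.

Local Notation dm := (cdom p).

(** The new domain is that of p together with the set Z of meets of C, the
    closure of {y, t} under the branches of models which pass through m and not
    through y.  A branch b of a model N, through a point of Z outside N, either
    passes through y, and then the condition p already gives it the value of y,
    or belongs to C.  The old domain and Z only meet in y, since a point of the
    old domain above m is above y. *)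
Lemma extend_condition t n : t ∈ T ->
  (forall x, dm x -> ~ lp (Node t) x) ->
  (forall N b s, N \in cmodels p -> b ∈ N -> branches T R b ->
     s ∈ T -> ~ s ∈ N -> ~ t ∈ b) ->
  exists q, [/\ sealing_condition T R SS TT q,
    forall x k, cfun p x = Some k -> cfun q x = Some k,
    cmodels q = cmodels p & exists2 k, cfun q (Node t) = Some k & n <= k].
Proof.
case: hp => -[dfin dpt ms] pmono pbranch pmeet_closed proot.
move=> tT t_dm t_br; pose tt := Node t.
have ptt : pt tt by [].
have dmm x y : dm x -> dm y -> dm (pmeet x y).
  by move=> dx dy; exact: (pmeet_closed _ _ _ dx dy (pmeetP (dpt _ dx) (dpt _ dy))).
have dple x : dm x -> ple x x by move=> /dpt; apply: ple_refl.
have [m [x0 dx0 mE] mmax0] : exists2 m, [set pmeet x tt | x in dm] m &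
    forall a, [set pmeet x tt | x in dm] a -> ple a m.
  apply: (@finite_directed _ (fun a b => ple b a)).
  - by move=> b a c ab bc; apply: ple_tr bc ab.
  - exact: finite_image.
  - by have [r rr] := rT; exists (pmeet (Node r) tt), (Node r) => //; rewrite /cdom /= proot.
  - move=> _ _ [x dx <-] [y dy <-].
    have px : ple (pmeet x tt) tt.
      by have /pleI[] := ple_meet (dple x dx) (ple_refl ptt).
    have py : ple (pmeet y tt) tt.
      by have /pleI[] := ple_meet (dple y dy) (ple_refl ptt).
    have [[xx _] [yy _]] := (ple_dom px, ple_dom py).
    case: (ple_lin px py) => h; first by exists (pmeet y tt); split=> //; exists y.
    by exists (pmeet x tt); split=> //; exists x.
have mm : ple m m by rewrite -mE; apply: ple_meet; [apply: dple | apply: ple_refl].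
have /pleI[mx0 mt] : ple m (pmeet x0 tt) by rewrite mE.
have mmax x w : dm x -> ple w x -> ple w tt -> ple w m.
  move=> dx wx wt; apply: (ple_tr (y := pmeet x tt)); first exact/pleI.
  by apply: mmax0; exists x.
(* m can be in the domain already; then y = m. *)
have [y [dy my] ymin] : exists2 y, [set x | dm x /\ ple m x] y &
    forall x, [set x | dm x /\ ple m x] x -> ple y x.
  apply: (@finite_directed _ ple).
  - exact: ple_tr.
  - by apply: sub_finite_set dfin => x [].
  - by exists x0.
  - move=> a b [da ma] [db mb]; exists (pmeet a b).
    have /pleI[] := ple_meet (dple a da) (dple b db).
    by split=> //; split; [apply: dmm | apply/pleI].
have yy := dple y dy.
have [v yv] : exists v, cfun p y = Some v by move: dy; rewrite /cdom /=; case: (cfun p y) => // v; exists v.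
have t_ndm x : dm x -> ~ ple tt x by move=> /t_dm h [].
have ytt : y <> tt by move=> e; apply: (t_ndm y dy); rewrite e; apply: ple_refl.
(* Br only has branches of models that miss some node of T; by t_br none of
   them passes through t. *)
pose out (N : V) := [set z | exists s, [/\ z = Node s, s ∈ T & ~ s ∈ N]].
pose Br (N : V) := [set c | exists b s, [/\ c = Branch b, N \in cmodels p, b ∈ N,
  branches T R b & [/\ s ∈ T, ~ s ∈ N, ple m c & ~ ple y c]]].
have Br_le N c : Br N c -> ple c c.
  by move=> [b [s [-> _ _ bb _]]]; apply: ple_refl.
have Br_uniq N z c c' : out N z -> Br N c -> Br N c' -> ple z c -> ple z c' -> c = c'.
  move=> [s [-> sT sN]] [b [_ [-> NM bN bb _]]] [b' [_ [-> _ b'N bb' _]]] [_ _ /= sb] [_ _ /= sb'].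
  by congr Branch; apply: model_split sT sN bN b'N bb bb' sb sb'.
pose G : set Defs.point := [set y; tt].
pose C := split_closure ple pmeet out Br (cmodels p) G.
pose Z := pair_meets pmeet C.
have Gple : G `<=` [set x | ple x x] by move=> x [->|->] //=; apply: ple_refl.
have Cple : C `<=` [set x | ple x x] by apply: (split_closure_le Br_le).
have Cm c : C c -> ple m c.
  elim=> [x [->|->]//|? ? ? ? _ _ _ _ _ _ [b [s [-> _ _ _ [//]]]]].
have Cy c : C c -> ple y c -> c = y \/ c = tt.
  elim=> [x //|? ? ? ? _ _ _ _ _ _ [b [s [-> _ _ _ [//]]]]].
have Ctt c : C c -> ple tt c -> c = tt.
  elim=> [x [->|->//] /(t_ndm y dy)//|? ? ? ? _ _ _ _ _ _ [b [s [-> NM bN bb [sT sN _ _]]]] _ [_ _ tb]].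
  by case: (t_br _ b s NM bN bb sT sN).
have Zm z : Z z -> ple m z by move=> [a /Cm ma [b /Cm mb <-]]; apply/pleI.
have Zple z : Z z -> ple z z by move=> /Zm/ple_dom[].
have Zpt z : Z z -> pt z by move=> /Zple[].
have meet_xx := meetxx ple_anti pleI ple_meet.
have meet_C := meetC ple_anti pleI ple_meet.
have ml := meet_l ple_tr ple_anti pleI ple_meet ple_dom.
have Zy z : Z z -> ple y z -> z = y \/ z = tt.
  move=> [a Ca [b Cb <-]] /pleI[ya yb].
  have [[ea|ea] [eb|eb]] := (Cy a Ca ya, Cy b Cb yb); rewrite ea eb in ya yb *.
  - by left; apply: meet_xx.
  - by left; apply: ml.
  - by left; rewrite meet_C; [apply: ml | apply: ple_refl | ].
  - by right; apply: meet_xx; apply: ple_refl.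
have Ztt z : Z z -> ple tt z -> z = tt.
  move=> [a Ca [b Cb <-]] /pleI[ya yb].
  by rewrite (Ctt a Ca ya) (Ctt b Cb yb); apply: meet_xx; apply: ple_refl.
have dZ x : dm x -> Z x -> x = y.
  move=> dx Zx; have yx : ple y x by apply: ymin; split=> //; apply: Zm.
  by case: (Zy x Zx yx) => // e; case: (t_ndm x dx); rewrite e; apply: ple_refl.
have CZ c : C c -> Z c by move=> Cc; apply: (meets_incl ple_anti pleI ple_meet (Cple c Cc) Cc).
have Cb_y : C y by apply: split_closure_base; left.
have Cb_t : C tt by apply: split_closure_base; right.
have ZI a b : Z a -> Z b -> Z (pmeet a b).
  by apply: (meets_meet ple_tr ple_anti ple_lin pleI ple_meet ple_dom Cple).
pose f x := if cfun p x is Some k then Some k else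
  if `[< Z x >] then Some (if x == tt then maxn v n else v) else None.
have fd x k : cfun p x = Some k -> f x = Some k by rewrite /f => ->.
have fZ x : Z x -> f x = Some (if x == tt then maxn v n else v).
  move=> Zx; rewrite /f; case e : (cfun p x) => [k|]; last by case: asboolP.
  have xy : x = y by apply: dZ => //; rewrite /cdom /= e.
  by rewrite xy yv in e; case: e => <-; case: eqP => // h; case: ytt; rewrite -xy.
have fZv x : Z x -> x <> tt -> f x = Some v by move=> /fZ ->; case: eqP.
have fdom x : f x <> None <-> dm x \/ Z x.
  rewrite /f /cdom /=; case: (cfun p x) => [k|]; first by split=> //; left.
  by case: asboolP => h; split=> //; [right | case].
pose q := Condition f (cmodels p).
have cdom_q x : cdom q x <-> dm x \/ Z x by exact: fdom.
have fold x : dm x -> f x = cfun p x.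
  by rewrite /f /cdom /=; case: (cfun p x).
exists q; split=> //; last first.
  by exists (maxn v n); [rewrite /= fZ ?eqxx //; apply: CZ | apply: leq_maxr].
split=> //.
- split=> //.
    apply: (@sub_finite_set _ _ (dm `|` Z)); first by move=> x /cdom_q.
    rewrite finite_setU; split=> //; apply: finite_image2;
      apply: (finite_split_closure ple_tr ple_anti ple_lin pleI ple_meet ple_dom Br_le Br_uniq) => //;
      by rewrite /G finite_setU.
  by move=> x /cdom_q[/dpt|/Zpt].
- move=> x1 x2 k1 k2 /= e1 e2 l12.
  have d1 : dm x1 \/ Z x1 by apply/fdom; rewrite e1.
  have d2 : dm x2 \/ Z x2 by apply/fdom; rewrite e2.
  have p1 : pt x1 by case: d1 => [/dpt|/Zpt].
  have p2 : pt x2 by case: d2 => [/dpt|/Zpt].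
  have {}l12 : ple x1 x2 by split.
  have lv k x : Z x -> f x = Some k -> v <= k.
    by move=> /fZ -> [<-]; case: eqP => // _; apply: leq_maxl.
  case: d1 => [d1|Z1].
    rewrite fold // in e1.
    case: d2 => [d2|Z2].
      by rewrite fold // in e2; case: l12 => _ _; apply: pmono e1 e2.
    apply: leq_trans (lv _ _ Z2 e2).
    have : ple x1 y.
      have [h|h] := ple_lin l12 (Zm x2 Z2); first exact: ple_tr my.
      have yx1 : ple y x1 by apply: ymin.
      have [x2y|x2t] := Zy x2 Z2 (ple_tr yx1 l12); first by rewrite -x2y.
      by apply: ple_tr my; apply: mmax d1 _ _; [case/ple_dom: l12 | rewrite -x2t].
    by move=> [_ _ x1y]; apply: pmono e1 yv x1y.
  have [x1t|x1t] := pselect (x1 = tt).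
    have x2t : x2 = tt.
      rewrite x1t in l12; case: d2 => [/t_ndm//|Z2]; exact: Ztt.
    by rewrite x1t in e1; rewrite x2t e1 in e2; case: e2 => ->.
  rewrite fZv // in e1; case: e1 => <-.
  case: d2 => [d2|Z2]; last exact: lv Z2 e2.
  rewrite fold // in e2.
  have [_ _ yx2] : ple y x2 by apply: ymin; split=> //; apply: ple_tr l12; apply: Zm.
  exact: pmono yv e2 yx2.
- move=> N b s NM bN bb /= /cdom_q ds sN sb.
  case: ds => [ds|Zs].
    have [h1 h2] := pbranch N b s NM bN bb ds sN sb.
    by split; [apply/cdom_q; left | rewrite !fold].
  have sT : s ∈ T by apply: branch_dom bb sb.
  have sc : ple (Node s) (Branch b) by split.
  have snt : Node s <> tt by move=> [e]; apply: (t_br N b s) => //; rewrite -e.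
  have bnt : Branch b <> tt by [].
  rewrite (fZv _ Zs snt).
  (* If y is below or equal to b, then y = s, or y = b, or y is a node above
     s and hence outside N; in each case b already has the value of y in p. *)
  have [yb|yb] := pselect (ple y (Branch b)).
    have [h|h] := ple_lin yb sc.
      have [e|//] := Zy _ Zs h.
      rewrite -e in dy yv; have [h1 h2] := pbranch N b s NM bN bb dy sN sb.
      by split; [apply/cdom_q; left | rewrite fold // h2].
    have [h1 h2] : dm (Branch b) /\ cfun p (Branch b) = Some v.
      case: (y) dy yv yb h => [u|c] dy yv [_ _ yb] [_ _ h]; last first.
        by move: yb => /= yb; rewrite -yb.
      by rewrite -yv; apply: (pbranch N b u) => // uN; apply: sN; apply: model_down uN h.
    by split; [apply/cdom_q; left | rewrite fold].
  have Zb : Z (Branch b).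
    apply: CZ; case: Zs => a Ca [a' Ca' e]; apply: (split_closure_step Ca Ca' NM).
    - by rewrite e; exists s.
    - exists b, s; split=> //; split=> //; apply: ple_tr sc.
      by rewrite -e; apply/pleI; split; apply: Cm.
    - by rewrite e.
  by split; [apply/cdom_q; right | rewrite fZv].
- move=> x1 x2 z /cdom_q d1 /cdom_q d2 mz; apply/cdom_q.
  have p1 : pt x1 by case: d1 => [/dpt|/Zpt].
  have p2 : pt x2 by case: d2 => [/dpt|/Zpt].
  have -> := is_meetE p1 p2 mz.
  (* An old point off m, and a new one, meet where the old one meets y; an old
     point above m is above y, and a new point off y meets both in one point. *)
  have mixed a b : dm a -> Z b -> dm (pmeet a b) \/ Z (pmeet a b).
    move=> da Zb.
    have [h|h] := pselect (ple m (pmeet b a)); last first.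
      left; rewrite meet_C; [|exact: dple|exact: Zple].
      rewrite -(meet_replace ple_tr ple_anti ple_lin pleI ple_meet ple_dom (dple a da) (Zm b Zb) h my).
      exact: dmm.
    have /pleI[_ ma] := h; have ya : ple y a by apply: ymin.
    have [h'|h'] := pselect (ple y (pmeet a b)); last first.
      right.
      rewrite -(meet_replace ple_tr ple_anti ple_lin pleI ple_meet ple_dom (Zple b Zb) ya h' yy).
      by apply: ZI => //; apply: CZ.
    left; have /pleI[_ yb] := h'.
    suff -> : pmeet a b = y by [].
    have pab := ple_meet (dple a da) (Zple b Zb).
    have /pleI[ha hb] := pab.
    apply: ple_anti h'.
    have [e|e] := Zy b Zb yb; rewrite e in pab ha hb * => //.
    by apply: ple_tr my; apply: mmax ha hb.
  case: d1 => [d1|Z1]; case: d2 => [d2|Z2].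
  - by left; apply: dmm.
  - exact: mixed.
  - by rewrite meet_C; [apply: mixed | apply: Zple | apply: dple].
  - by right; apply: ZI.
- by move=> r /proot /fd.
Qed.

End Extend.
End Points.

(** * Elementary submodels of H(omega_2) *)

Section Models.

Lemma sat_exA A v a : sat A v (fEx a) <-> exists2 x, A x & sat A (scons x v) a.
Proof.
rewrite /=; split=> [h|[x Ax sx] /(_ x Ax)//].
by apply: contrapT => n; apply: h => x Ax sx; apply: n; exists x.
Qed.

Lemma sat_allA A v a : sat A v (fAll a) <-> forall x, A x -> sat A (scons x v) a.
Proof. by []. Qed.

Section Absolute.
Context (A : set V).
Hypothesis Atr : forall x y, A x -> y ∈ x -> A y.

Lemma sat_upairA v z x y : A (v z) -> A (v x) -> A (v y) ->
  (sat A v (f_upair z x y) <-> v z = upair (v x) (v y)).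
Proof.
move=> Az Ax Ay.
have E w : w ∈ upair (v x) (v y) <-> w = v x \/ w = v y by rewrite inVE elts_upair.
split=> [/sat_allA h|e].
  apply: elts_inj; apply/seteqP; split=> w; rewrite -!inVE.
    move=> wz; have /sat_fIff h1 := h w (Atr Az wz).
    by apply/E; move: wz => /(iffLR h1)/sat_fOr.
  move=> /E wxy; have Aw : A w by case: wxy => ->.
  by have /sat_fIff h1 := h w Aw; apply: (iffRL h1); apply/sat_fOr.
apply/sat_allA => w Aw; have {}E : w ∈ v z <-> w = v x \/ w = v y by rewrite e.
apply/sat_fIff; split; last by move=> /sat_fOr; apply: (iffRL E).
by move=> /(iffLR E) h; apply/sat_fOr.
Qed.

Lemma sat_opairA v z x y : A (v z) -> A (v x) -> A (v y) ->
  (sat A v (f_opair z x y) <-> v z = opair (v x) (v y)).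
Proof.
move=> Az Ax Ay; split.
  move=> /sat_exA[s As /sat_exA[t At /sat_fAnd[h1 /sat_fAnd[h2 h3]]]].
  move/sat_upairA: h1 => /(_ As Ax Ax)/= es; move/sat_upairA: h2 => /(_ At Ax Ay)/= et.
  by move/sat_upairA: h3 => /(_ Az As At)/=; rewrite es et.
move=> e.
have [u1 u2] : upair (v x) (v x) ∈ v z /\ upair (v x) (v y) ∈ v z.
  by rewrite e !inVE /opair !elts_upair; split; [left | right].
have [A1 A2] := (Atr Az u1, Atr Az u2).
apply/sat_exA; exists (upair (v x) (v x)) => //; apply/sat_exA.
by exists (upair (v x) (v y)) => //; do 2?[apply/sat_fAnd; split]; apply/sat_upairA.
Qed.

Lemma sat_relA v r x y : A (v r) -> A (v x) -> A (v y) ->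
  (sat A v (f_rel r x y) <-> opair (v x) (v y) ∈ v r).
Proof.
move=> Ar Ax Ay; split.
  by move=> /sat_exA[z Az /sat_fAnd[/sat_opairA <-]].
move=> h; have Ap := Atr Ar h; apply/sat_exA; exists (opair (v x) (v y)) => //.
by apply/sat_fAnd; split=> //; apply/sat_opairA.
Qed.

End Absolute.

Lemma trcl_tr x y z : y ∈ x -> trcl y z -> trcl x z.
Proof. by move=> yx h t tt xt; apply: h => //; apply: tt; apply: xt. Qed.

Lemma Homega2_tr x y : Homega2 x -> y ∈ x -> Homega2 y.
Proof.
move=> /negP Hx yx; apply/negP => h; apply: Hx; apply: card_le_trans h _.
by apply: subset_card_le => z; apply: trcl_tr.
Qed.

(** The points of Y outside X go to the even natural numbers, which are free
    once every natural number has been moved to an odd one. *)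
Lemma card_absorb (X Y : set V) : range natV `<=` X -> countable Y ->
  X `|` Y #<= X.
Proof.
move=> nX /countable_injP[h hi].
pose num w := xget 0%N [set k | natV k = w].
have numK k : num (natV k) = k by apply: xget_unique => // j; apply: natV_inj.
pose F w := if `[< range natV w >] then natV (num w).*2.+1 else
            if `[< X w >] then w else natV (h w).*2.
apply/pcard_leP/injfunPex; exists F.
  move=> w XYw /=; rewrite /F; case: asboolP => _; first by apply: nX; exists (num w).*2.+1.
  by case: asboolP => // _; apply: nX; exists (h w).*2.
have XY w : (X `|` Y) w -> ~ X w -> w \in Y by move=> [//|Yw _]; apply/mem_set.
move=> a b /set_mem Sa /set_mem Sb; rewrite /F.
case: (asboolP (range natV a)) => [[k _ <-]|na];
  case: (asboolP (range natV b)) => [[j _ <-]|nb]; rewrite ?numK.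
- by move=> /natV_inj e; congr natV; apply: double_inj; case: e.
- case: asboolP => Xb; first by move=> e; case: nb; exists k.*2.+1.
  by move=> /natV_inj e; have := congr1 odd e; rewrite /= !odd_double.
- case: asboolP => Xa; first by move=> e; case: na; exists j.*2.+1.
  by move=> /natV_inj e; have := congr1 odd e; rewrite /= !odd_double.
case: asboolP => Xa; case: asboolP => Xb //.
- by move=> e; case: na; exists (h b).*2.
- by move=> e; case: nb; exists (h a).*2.
- by move=> /natV_inj/double_inj; apply: hi; apply: XY.
Qed.

Context (N : V).
Hypothesis NH : Homega2 N.
Hypothesis Nel : elementary (elts N) Homega2.
Hypothesis Nw : omega ∈ N.

Let NsubH x : x ∈ N -> Homega2 x. Proof. by case: Nel => _ h _; apply: h. Qed.

(** The form in which elementarity is used: N has a witness for whatever has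
    one in H(omega_2). *)
Lemma elem_witness phi v : (forall n, v n ∈ N) ->
  (exists2 x, Homega2 x & sat Homega2 (scons x v) phi) ->
  exists2 x, x ∈ N & sat Homega2 (scons x v) phi.
Proof.
case: (Nel) => _ _ el vN /sat_exA/(el _ _ vN)/sat_exA[x xN sx]; exists x => //.
by apply/el => // -[|n] //=; apply: vN.
Qed.

Lemma model_natV k : natV k ∈ N.
Proof.
have natH j : Homega2 (natV j).
  by apply: Homega2_tr (NsubH Nw) _; apply/mem_omega; exists j.
elim: k => [|k IH].
  have [|x xN sx] := @elem_witness (fAll (fNot (fMem 0 1))) (fun _ => omega) (fun _ => Nw).
    exists emptyV; first exact: (natH 0).
    by move=> w _ /=; rewrite inVE elts_emptyV.
  suff <- : x = natV 0 by [].
  apply: elts_inj; rewrite elts_emptyV -subset0 => w wx.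
  exact: (sx w (Homega2_tr (NsubH xN) wx)).
pose phi := fAll (fIff (fMem 0 1) (fOr (fMem 0 2) (fEq 0 2))).
have [|x xN sx] := @elem_witness phi (fun _ => natV k) (fun _ => IH).
  exists (natV k.+1) => //; apply/sat_allA => w _; apply/sat_fIff.
  have E : w ∈ natV k.+1 <-> w ∈ natV k \/ w = natV k.
    by rewrite [X in X <-> _]inVE elts_natVS.
  split; first by move=> h; apply/sat_fOr/E.
  by move=> /sat_fOr h; apply: (iffRL E).
move/sat_allA: sx => sx; suff <- : x = natV k.+1 by [].
apply: elts_inj; rewrite elts_natVS; apply/seteqP; split=> w.
  move=> wx; have /sat_fIff h := sx w (Homega2_tr (NsubH xN) wx).
  by move: wx => /(iffLR h)/sat_fOr.
move=> wk; have Hw : Homega2 w.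
  by case: wk => [|-> //]; apply: Homega2_tr (natH k).
by have /sat_fIff h := sx w Hw; apply: (iffRL h); apply/sat_fOr.
Qed.

(** The transitive closure of N is infinite, so it absorbs the countably many
    pairs that have to be added to it; this bounds the transitive closure of
    the sequence without any arithmetic of omega_2. *)
Lemma Homega2_seq (g : nat -> V) : (forall k, trcl N (g k)) ->
  Homega2 (Defs.set_of (range (fun k => opair (natV k) (g k)))).
Proof.
move=> gN; set f := Defs.set_of _.
have ef : elts f = range (fun k => opair (natV k) (g k)).
  by apply: elts_set_of; apply: small_range.
have trN x y : trcl N x -> y ∈ x -> trcl N y.
  by move=> xN yx t tt Nt; apply: (tt x (xN t tt Nt)).
have NtrN x : x ∈ N -> trcl N x by move=> xN t _ Nt; apply: Nt.
pose Y := range (fun k => opair (natV k) (g k)) `|`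
  (range (fun k => upair (natV k) (natV k)) `|` range (fun k => upair (natV k) (g k))).
have cY : countable Y.
  have cr (e : nat -> V) : countable (range e) by apply: sub_countable (card_image_le _ _) _.
  rewrite /Y !setUA -!bigcup2E; apply: bigcup_countable => // i _.
  rewrite /bigcup2; case: i => [|[|i]] //=; apply: bigcup_countable => // i _.
  by case: i => [|[|i]] /=.
have XY : trcl N `|` Y #<= trcl N.
  by apply: card_absorb cY => _ [k _ <-]; apply/NtrN/model_natV.
have [t tt Nt] : exists2 t, transitiveV t & elts N `<=` elts t.
  apply: contrapT => n; move/negP: NH; apply; apply: subset_card_le => x _ t tt Nt.
  by case: n; exists t.
have sS : is_small (trcl N `|` Y).
  have sY : is_small Y.
    exists (nat + (nat + nat))%type, (fun i => match i with
      | inl k => opair (natV k) (g k) | inr (inl k) => upair (natV k) (natV k)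
      | inr (inr k) => upair (natV k) (g k) end).
    move=> _ [|[]] [k _ <-]; by [exists (inl k) | exists (inr (inl k)) | exists (inr (inr k))].
  have [I [e eI]] := small_elts t; have [J [d dJ]] := sY.
  exists (I + J)%type, (fun i => match i with inl i => e i | inr j => d j end).
  move=> x [xN|/dJ[j _ <-]]; last by exists (inr j).
  by have /eI[i _ <-] := xN t tt Nt; exists (inl i).
apply/negP => h; move/negP: NH; apply; apply: card_le_trans XY.
apply: card_le_trans h _; apply: subset_card_le => x.
rewrite -(elts_set_of sS); apply.
  have E w : w ∈ Defs.set_of (trcl N `|` Y) <-> trcl N w \/ Y w by rewrite inVE elts_set_of.
  have up a b w : w ∈ upair a b <-> w = a \/ w = b by rewrite inVE elts_upair.
  have nN k : trcl N (natV k) by apply/NtrN/model_natV.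
  move=> y /E yS w wy; apply/E; move: yS => [yN|]; first by left; apply: trN wy.
  case=> [[k _ ek]|[[k _ ek]|[k _ ek]]]; rewrite -ek in wy.
  - by right; right; case/up: wy => ->; [left | right]; exists k.
  - by left; case/up: wy => ->.
  - by left; case/up: wy => ->.
by rewrite ef elts_set_of // => w yw; right; left.
Qed.

Context (T R : V).
Hypothesis hT : omega1_tree T R.
Hypothesis TRN : opair T R ∈ N.

Lemma model_TR : T ∈ N /\ R ∈ N.
Proof.
have HTR := NsubH TRN.
have [UT UR] : upair T T ∈ opair T R /\ upair T R ∈ opair T R.
  by rewrite !inVE /opair !elts_upair; split; [left|right].
have [HT HR] : Homega2 T /\ Homega2 R.
  by split; apply: Homega2_tr (Homega2_tr HTR UR) _; rewrite inVE elts_upair; [left|right].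
have [|T' T'N /sat_exA[R' HR' e]] := @elem_witness (fEx (f_opair 2 1 0)) (fun _ => opair T R) (fun _ => TRN).
  exists T => //; apply/sat_exA; exists R => //.
  by apply/(sat_opairA Homega2_tr).
have /opair_inj[eT eR] : opair T R = opair T' R'.
  by apply: (iffLR (sat_opairA Homega2_tr (v := scons R' (scons T' _)) (z := 2) (x := 1) (y := 0) _ _ _)) e => //=; apply: NsubH.
have TN : T ∈ N by rewrite eT.
split=> //.
have [||R2 R2N e2] := @elem_witness (f_opair 2 1 0) (scons T (fun _ => opair T R)).
- by case.
- by exists R => //; apply/(sat_opairA Homega2_tr).
have /opair_inj[_ -> //] : opair T R = opair T R2.
apply: (iffLR (sat_opairA Homega2_tr (v := scons R2 (scons T _)) (z := 2) (x := 1) (y := 0) _ _ _)) e2 => //=.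
exact: NsubH.
Qed.

Lemma countable_down z : z ∈ T -> countable [set x | leT R x z].
Proof.
case: hT => tT _ lev _ _ zT; have [a aw [_ [g gb _]]] := lev z zT.
have [_ ca] : Defs.ordinal a /\ elts a #<= elts omega by move: aw; rewrite inVE elts_hartogs.
apply: (@sub_countable _ _ _ (below R z `|` [set z])).
  apply: subset_card_le => x xz; have [->|n] := pselect (x = z); first by right.
  by left.
rewrite -bigcup2E; apply: bigcup_countable => // -[|[|i]] _ //=.
have /pcard_eqP/card_esym/eq_countable -> : $|{bij elts a >-> below R z}| by apply/bijPex; exists g.
apply: sub_countable ca _; rewrite elts_omega.
exact: sub_countable (card_image_le _ _) _.
Qed.

(** By elementarity N contains an enumeration f of the predecessors of z by
    natural numbers.  As N contains every natural number, it contains all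
    values of f. *)
Lemma model_downward x z : z ∈ N -> leT R x z -> x ∈ N.
Proof.
move=> zN xz; have [TN RN] := model_TR.
have hR : is_tree T R by case: hT.
have zT : z ∈ T by case: (leT_dom hR xz).
have [g gP] : exists g : nat -> V, range g = [set x | leT R x z].
  have /pcard_surjP[g gs] := countable_down zT.
  exists (fun k => if `[< leT R (g k) z >] then g k else z).
  apply/seteqP; split=> [_ [k _ <-]|y yz] /=.
    by case: asboolP => // _; apply: (leT_refl hR).
  have [k _ gk] := gs y yz; exists k => //; rewrite gk.
  by case: asboolP.
have gz k : leT R (g k) z by have : range g (g k) by [exists k]; rewrite gP.
set fx := Defs.set_of (range (fun k => opair (natV k) (g k))).
have fE n y : opair n y ∈ fx <-> exists k, n = natV k /\ y = g k.
  rewrite inVE elts_set_of; last exact: small_range.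
  by split=> [[k _ /opair_inj[<- <-]]|[k [-> ->]]]; exists k.
have trH := Homega2_tr.
(* phi1: f is a function; phi2: every predecessor of z is a value of f on omega. *)
pose phi1 := fAll (fAll (fAll (fImp (fAnd (f_rel 3 2 1) (f_rel 3 2 0)) (fEq 1 0)))).
pose phi2 := fAll (fImp (f_rel 3 0 2) (fEx (fAnd (fMem 0 5) (f_rel 2 0 1)))).
pose v := scons z (scons R (fun _ => omega)).
have vN n : v n ∈ N by case: n => [|[|n]].
have vH n : Homega2 (v n) by apply: NsubH.
have Hfx : Homega2 fx.
  apply: Homega2_seq => k; have gT : g k ∈ T by case: (leT_dom hR (gz k)).
  by move=> t tt Nt; apply: tt gT; apply: Nt.
have [|f fN /sat_fAnd[s1 s2]] := @elem_witness (fAnd phi1 phi2) v vN.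
  exists fx => //; apply/sat_fAnd; split.
    apply/sat_allA => n Hn; apply/sat_allA => y Hy; apply/sat_allA => y' Hy'; apply/sat_fImp => /sat_fAnd[].
    move=> /(sat_relA trH)-/(_ Hfx Hn Hy)/fE[k [nk yk]].
    move=> /(sat_relA trH)-/(_ Hfx Hn Hy')/fE[k' [nk' yk']].
    rewrite /= in nk nk' yk yk' *; rewrite nk in nk'.
    by rewrite yk yk' (natV_inj nk').
  apply/sat_allA => y Hy; apply/sat_fImp => /(sat_relA trH)-/(_ (vH 1) Hy (vH 0)) yz; rewrite /= in yz.
  have [k _ gk] : range g y by rewrite gP.
  have nw : natV k ∈ omega by apply/mem_omega; exists k.
  have Hn := trH _ _ (NsubH Nw) nw.
  apply/sat_exA; exists (natV k) => //; apply/sat_fAnd; split=> //.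
  by apply/(sat_relA trH) => //; apply/fE; exists k.
have Hf := NsubH fN; move/sat_allA: s1 => s1; move/sat_allA: s2 => s2.
have Hx : Homega2 x by apply: trH (NsubH TN) _; case: (leT_dom hR xz).
have /sat_fImp s2x := s2 x Hx.
have /s2x/sat_exA[n Hn] : sat Homega2 (scons x (scons f v)) (f_rel 3 0 2).
  by apply/(sat_relA trH) => //; [exact: (vH 1) | exact: (vH 0)].
move=>  /sat_fAnd[nw nx].
have {}nx : opair n x ∈ f by move: nx => /(sat_relA trH); apply.
have nN : n ∈ N by move: nw => /= /mem_omega[k ->]; apply: model_natV.
have [||y yN ny] := @elem_witness (f_rel 2 1 0) (scons n (fun _ => f)).
- by case.
- by exists x => //; apply/(sat_relA trH).
have Hy := NsubH yN.
have {}ny : opair n y ∈ f by move: ny => /(sat_relA trH); apply.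
suff <- : y = x by [].
have /sat_allA/(_ y Hy)/sat_allA/(_ x Hx)/sat_fImp := s1 n Hn; apply.
by split; apply/(sat_relA trH).
Qed.

(** N sees some x that distinguishes b from c.  If s is on both branches, it is
    below x, hence in N. *)
Lemma model_split_branch s b c : ~ s ∈ N -> b ∈ N -> c ∈ N ->
  branches T R b -> branches T R c -> s ∈ b -> s ∈ c -> b = c.
Proof.
move=> sN.
suff half b' c' : b' ∈ N -> c' ∈ N -> branches T R b' -> branches T R c' ->
    s ∈ b' -> s ∈ c' -> elts b' `<=` elts c'.
  by move=> *; apply: elts_inj; apply/seteqP; split; apply: half.
move=> bN cN [_ b_chain _ _] [_ _ c_down _] sb sc w wb.
apply: contrapT => wc.
have [||x xN [xb xc]] := @elem_witness (fAnd (fMem 0 1) (fNot (fMem 0 2))) (scons b' (fun _ => c')).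
- by case.
- by exists w; [apply: Homega2_tr (NsubH bN) wb | split].
case: (b_chain x s xb sb) => h; last by apply: sN; apply: model_downward xN h.
by apply: xc; apply: c_down sc h.
Qed.

End Models.

(** * Forcing omega_1 to be countable *)

Section Collapse.
Context (P : Type) (le : P -> P -> Prop).
Hypothesis fle : forcing_notion le.

Let lexx p : le p p. Proof. by case: fle. Qed.
Let le_tr q p r : le p q -> le q r -> le p r.
Proof. by case: fle => _ _; apply. Qed.

(** The relation S m a r says that r decides the value at m, to be a, of a
    partial map from the natural numbers onto omega_1.  The bijection lists the
    values of this map in the order of their first occurrence. *)
Section Enumeration.
Context (S : nat -> V -> P -> Prop) (p0 : P).
Hypothesis S_open : forall m a q r, le r q -> S m a q -> S m a r.
Hypothesis S_fun : forall m a a' q, le q p0 -> S m a q -> S m a' q -> a = a'.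
Hypothesis S_omega1 : forall m a q, S m a q -> a ∈ omega1.
Hypothesis S_cover : forall a, a ∈ omega1 -> dense_below le p0 (fun q => exists m, S m a q).

(** None stands for a place at which r decides that the map is undefined. *)
Definition decided (l : seq (option V)) (r : P) : Prop :=
  forall i, i < size l -> match nth None l i with
    | Some a => S i a r
    | None => forall q a, le q r -> ~ S i a q
    end.

(** As undup keeps last occurrences, the reversals make it keep the first ones,
    so that a longer list only adds values at the end. *)
Definition listing (l : seq (option V)) : seq V := rev (undup (rev (pmap id l))).

Definition enumerates (a : V) (n : nat) (r : P) : Prop :=
  exists l, [/\ decided l r, n < size (listing l) & nth emptyV (listing l) n = a].

Lemma decided_open l q r : le r q -> decided l q -> decided l r.
Proof.
move=> rq h i il; have := h i il; case: (nth None l i) => [a|]; first exact: S_open.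
by move=> n q' a q'r; apply: n; apply: le_tr rq.
Qed.

Lemma decided_take l l' r : le r p0 -> decided l r -> decided l' r ->
  size l <= size l' -> l = take (size l) l'.
Proof.
move=> rp dl dl' ll'; apply: (@eq_from_nth _ None); first by rewrite size_takel.
move=> i il; rewrite nth_take //.
have := dl i il; have := dl' i (leq_trans il ll').
case: (nth None l i) => [a|]; case: (nth None l' i) => [a'|] //.
- by move=> s s'; rewrite (S_fun rp s s').
- by move=> h /(h _ _ (lexx r)).
- by move=> s /(_ _ _ (lexx r) s).
Qed.

Lemma listing_cat l l' : exists l2, listing (l ++ l') = listing l ++ l2.
Proof.
rewrite /listing pmap_cat rev_cat undup_cat rev_cat.
by eexists.
Qed.

Lemma listing_uniq l : uniq (listing l).
Proof. by rewrite rev_uniq undup_uniq. Qed.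

Lemma mem_listing l a : (a \in listing l) = (Some a \in l).
Proof. by rewrite mem_rev mem_undup mem_rev mem_pmap map_id. Qed.

Lemma enumerates_common a n a' n' r : le r p0 -> enumerates a n r -> enumerates a' n' r ->
  exists2 L : seq V, uniq L &
    [/\ n < size L, n' < size L, nth emptyV L n = a & nth emptyV L n' = a'].
Proof.
move=> rp.
wlog ll' : a n a' n' / exists l l', [/\ size l <= size l', decided l r & decided l' r] /\
    [/\ n < size (listing l), nth emptyV (listing l) n = a,
        n' < size (listing l') & nth emptyV (listing l') n' = a'].
  move=> W [l [dl nl al]] [l' [dl' nl' al']].
  have [ll'|/ltnW ll'] := leqP (size l) (size l').
    apply: W; last 2 first; try by [exists l; split | exists l'; split].
    by exists l, l'.
  have [|||L uL [h1 h2 h3 h4]] := W a' n' a n; last 1 first.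
  - by exists L.
  - by exists l', l.
  - by exists l'; split.
  - by exists l; split.
move=> _ _; have [l [l' [[ll dl dl'] [nl al nl' al']]]] := ll'.
exists (listing l'); first exact: listing_uniq.
have [l2 e] := listing_cat l (drop (size l) l').
rewrite {1}(decided_take rp dl dl' ll) cat_take_drop in e.
by split=> //; rewrite e ?size_cat ?nth_cat ?nl ?(leq_trans nl) ?leq_addr.
Qed.

Lemma decided_dense k : dense_below le p0 (fun q => exists2 l, decided l q & size l = k).
Proof.
elim: k => [|k IH] q qp; first by exists q => //; exists [::].
have [r rq [l dl lk]] := IH q qp; have rp := le_tr rq qp.
have [[r' [a [r'r Sa]]]|no] := pselect (exists r' a, le r' r /\ S k a r').
  exists r'; first exact: le_tr rq.
  exists (rcons l (Some a)); last by rewrite size_rcons lk.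
  move=> i; rewrite size_rcons ltnS leq_eqVlt nth_rcons => /orP[/eqP ->|il].
    by rewrite ltnn eqxx lk.
  by rewrite il; apply: (decided_open r'r dl).
exists r => //; exists (rcons l None); last by rewrite size_rcons lk.
move=> i; rewrite size_rcons ltnS leq_eqVlt nth_rcons => /orP[/eqP ->|il].
  by rewrite ltnn eqxx => r' a r'r; rewrite lk => Sa; apply: no; exists r', a.
by rewrite il; apply: dl.
Qed.

Lemma decided_mem l m a r : le r p0 -> decided l r -> m < size l -> S m a r -> a \in listing l.
Proof.
move=> rp dl ml Sa; rewrite mem_listing; have := dl m ml.
case e : (nth None l m) => [a'|]; last by move=> /(_ _ _ (lexx r) Sa).
by move=> Sa'; rewrite (S_fun rp Sa Sa') -e mem_nth.
Qed.

Lemma forces_equinumerous_of_cover (v : nat -> PName P) :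
  v 0 = check P omega1 -> v 1 = check P omega ->
  forces le p0 v (f_equinumerous 0 1).
Proof.
move=> v0 v1; rewrite /f_equinumerous; apply/(forces_ex le).
apply: (dense_here fle) => q qp.
exists (bijN enumerates); apply: (forces_mono fle qp).
have en_open a n r r' : le r' r -> enumerates a n r -> enumerates a n r'.
  by move=> r'r [l [dl nl al]]; exists l; split=> //; apply: decided_open dl.
apply: (forces_bij fle (J := enumerates)) => //.
- move=> a n n' r rp e e'; have [L uL [nL n'L <- /eqP]] := enumerates_common rp e e'.
  by rewrite nth_uniq // => /eqP ->.
- by move=> a a' n r rp e e'; have [L uL [nL n'L <- <-]] := enumerates_common rp e e'.
- move=> a aw r rp.
  have [r1 r1r [m Sm]] := S_cover aw rp; have r1p := le_tr r1r rp.
  have [r2 r2r [l dl lm]] := @decided_dense m.+1 r1 r1p; have r2p := le_tr r2r r1p.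
  have al : a \in listing l by apply: (decided_mem r2p dl _ (S_open r2r Sm)); rewrite lm.
  exists r2; first exact: le_tr r1r.
  by exists (index a (listing l)), l; split=> //; [rewrite index_mem | apply: nth_index].
- move=> n r rp.
  have [r1 r1r [M SM]] : exists2 r1, le r1 r &
      exists M, forall j, j < n.+1 -> exists2 m, m < M & S m (natV j) r1.
    elim: n.+1 => [|k [r1 r1r [M SM]]]; first by exists r => //; exists 0.
    have [r2 r2r [m Sm]] := S_cover (natV_omega1 k) (le_tr r1r rp).
    exists r2; first exact: le_tr r1r.
    exists (maxn M m.+1) => j; rewrite ltnS leq_eqVlt => /orP[/eqP ->|/SM[m' m'M Sm']].
      by exists m => //; apply: leq_maxr.
    by exists m'; [apply: leq_trans (leq_maxl _ _) | apply: S_open Sm'].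
  have r1p := le_tr r1r rp.
  have [r2 r2r [l dl lm]] := @decided_dense M r1 r1p; have r2p := le_tr r2r r1p.
  have nl : n < size (listing l).
    rewrite -[n.+1](size_iota 0) -(size_map natV); apply: uniq_leq_size.
      by rewrite map_inj_uniq ?iota_uniq //; apply: natV_inj.
    move=> _ /mapP[j jn ->]; rewrite mem_iota /= add0n in jn.
    have [m mM Sm] := SM j jn.
    by apply: (decided_mem r2p dl _ (S_open r2r Sm)); rewrite lm.
  exists r2; first exact: le_tr r1r.
  exists (nth emptyV (listing l) n); last by exists l.
  have : nth emptyV (listing l) n \in listing l by apply: mem_nth.
  rewrite mem_listing => /(nthP None)[i il e]; have := dl i il; rewrite e.
  exact: S_omega1.
Qed.

End Enumeration.

(** Here B t r says that r forces t into a chain, and G k t r that r decides t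
    to have some property of index k.  The criterion asks that the places
    where the properties first hold be cofinal in the chain. *)
Section Cofinal.
Context (T R : V).
Hypothesis hT : omega1_tree T R.

Let tT : is_tree T R. Proof. by case: hT. Qed.

(** Both a and b are isomorphic to the set of predecessors of s. *)
Lemma level_uniq a b s : a ∈ omega1 -> b ∈ omega1 -> level T R a s -> level T R b s -> a = b.
Proof.
have tr x : x ∈ omega1 -> transitiveV x by rewrite inVE elts_hartogs => -[[]].
move=> /tr ta /tr tb [_ [g gb gP]] [_ [h hb hP]].
have half x y (k l : V -> V) : set_bij (elts x) (below R s) k -> set_bij (elts y) (below R s) l ->
  (forall i j, i ∈ x -> j ∈ x -> (i ∈ j <-> below R (k j) (k i))) ->
  (forall i j, i ∈ y -> j ∈ y -> (i ∈ j <-> below R (l j) (l i))) ->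
  [set uv | [/\ uv.1 ∈ x, uv.2 ∈ x & uv.1 ∈ uv.2 \/ uv.1 = uv.2]]
  `<=` [set uv | exists u' v', [/\ k uv.1 = l u', k uv.2 = l v', u' ∈ y,
                                   v' ∈ y & u' ∈ v' \/ u' = v']].
  move=> [kf ki ks] [lf li ls] kP lP [u v] /= [ux vx uv].
  have [u' u'y eu] := ls _ (kf u ux); have [v' v'y ev] := ls _ (kf v vx).
  exists u', v'; split=> //; case: uv => [uv|uv].
    by left; apply/lP => //; rewrite eu ev; apply/kP.
  by right; apply: li; rewrite ?inE // eu ev uv.
have [_ gi _] := gb; have [_ hi _] := hb.
by apply: (transitiveV_rigid ta tb gi hi); apply: half.
Qed.

Lemma tree_min (A : set V) : A `<=` elts T -> A !=set0 ->
  exists2 m, A m & forall x, A x -> leT R x m -> x = m.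
Proof.
move=> AT [t At].
have [[u [Au ut]]|no] := pselect (exists u, A u /\ below R t u); last first.
  exists t => // x Ax xt; apply: contrapT => n; apply: no.
  by exists x.
case: (tT) => _ _ _ _ /(_ t (AT _ At) (A `&` below R t))[].
- by move=> x [].
- by exists u.
move=> m [Am mt] mP; exists m => // x Ax xm.
apply: (leT_anti tT) => //; apply: mP; split=> //; split.
  by apply: (leT_tr tT) xm _; case: mt.
by move=> e; case: mt => mt n; apply: n; apply: (leT_anti tT) => //; rewrite -e.
Qed.

Context (B : V -> P -> Prop) (G : nat -> V -> P -> Prop) (p0 : P).
Hypothesis B_chain : forall s t r, B s r -> B t r -> leT R s t \/ leT R t s.
Hypothesis G_open : forall k t q r, le r q -> G k t q -> G k t r.
Hypothesis GB : forall k t r, G k t r -> B t r.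
Hypothesis BT : forall t r, B t r -> t ∈ T.
Hypothesis G_cofinal : forall r a, le r p0 -> a ∈ omega1 ->
  exists r' s k t, [/\ le r' r, level T R a s, G k t r' &
    forall r'' t', le r'' r' -> G k t' r'' -> leT R s t'].

Definition least_node k t r :=
  G k t r /\ forall r' t', le r' r -> G k t' r' -> leT R t' t -> t' = t.

(** Enumerate in V the predecessors of every node.  The pair (k, i) is sent to
    the level of the i-th predecessor of the least node with the property of
    index k.  Since the least nodes are cofinal, every level is reached. *)
Lemma forces_equinumerous_of_cofinal (v : nat -> PName P) :
  v 0 = check P omega1 -> v 1 = check P omega ->
  forces le p0 v (f_equinumerous 0 1).
Proof.
have /choice[code codeP] : forall t, exists c : V -> nat,
    t ∈ T -> {in [set x | leT R x t] &, injective c}.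
  move=> t; have [tt|n] := pselect (t ∈ T); last by exists (fun _ => 0).
  by have /countable_injP[c ci] := countable_down hT tt; exists c.
pose S m a r := exists k i t s, [/\ m = choice.pickle (k, i), least_node k t r,
  leT R s t /\ code t s = i & a ∈ omega1 /\ level T R a s].
apply: (@forces_equinumerous_of_cover S p0).
- move=> m a q r rq [k [i [t [s [-> [Gt tmin] st as_]]]]]; exists k, i, t, s; split=> //.
  by split; [apply: G_open Gt | move=> r' t' r'r; apply: tmin; apply: le_tr rq].
- move=> m a a' q _ [k [i [t [s [-> [Gt tmin] [st ci] [aw as_]]]]]].
  move=> [k' [i' [t' [s' [/(pcan_inj choice.pickleK)[<- <-] [Gt' tmin'] [st' ci'] [aw' as']]]]]].
  have tt' : t = t'.
    case: (B_chain (GB Gt) (GB Gt')) => h; first exact: (tmin' q).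
    by apply/esym/(tmin q).
  rewrite -tt' in st' ci'.
  have ss' : s = s'.
    by apply: (codeP t (BT (GB Gt))); rewrite ?inE //; rewrite ci ci'.
  by rewrite -ss' in as'; apply: level_uniq as_ as'.
- by move=> m a q [k [i [t [s [_ _ _ []]]]]].
- move=> a aw r rp; have [r1 [s [k [t [r1r as_ Gt Gs]]]]] := G_cofinal rp aw.
  have [m [mt [r2 r2r Gm]] mmin] : exists2 m,
      [set u | leT R u t /\ exists2 r2, le r2 r1 & G k u r2] m &
      forall x, [set u | leT R u t /\ exists2 r2, le r2 r1 & G k u r2] x -> leT R x m -> x = m.
    apply: tree_min; first by move=> u [/(leT_dom tT)[]].
    exists t; split; first by apply: (leT_refl tT); apply: BT (GB Gt).
    by exists r1.
  exists r2; first exact: le_tr r1r.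
  exists (choice.pickle (k, code m s)), k, (code m s), m, s; split=> //; last first.
    by split=> //; apply: Gs r2r Gm.
  split=> // r3 u r3r Gu um; apply: mmin => //; split; first exact: (leT_tr tT) mt.
  by exists r3 => //; apply: le_tr r2r.
Qed.

End Cofinal.
End Collapse.

(** * The name of a new branch *)

Section BranchName.
Context (T R : V).
Hypothesis hT : omega1_tree T R.
Context (Q : smallType) (leQ : Q -> Q -> Prop).
Hypothesis fQ : forcing_notion leQ.
Context (b : PName Q).
Hypothesis hbranch : forced leQ (f_branch 0 1 2 3)
    [:: b; check Q T; check Q R; check Q (levels T R)].
Hypothesis hnew : forall x : V, forced leQ (fNot (fEq 0 1)) [:: b; check Q x].

Let tT : is_tree T R. Proof. by case: hT. Qed.

Definition in_branch (t : V) (q : Q) : Prop := forces_mem leQ (check Q t) b q.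

Lemma in_branch_open t q r : leQ r q -> in_branch t q -> in_branch t r.
Proof. exact: (forces_mem_mono fQ). Qed.

Lemma in_branch_stable t q : dense_below leQ q (in_branch t) -> in_branch t q.
Proof. exact: (forces_mem_stable fQ). Qed.

Lemma mem_branch z q : forces_mem leQ z b q ->
  dense_below leQ q (fun r => exists2 t, in_branch t r & forces_eq leQ z (check Q t) r).
Proof.
have [_ rf _] := fQ.
move=> zb; have /(forces_and leQ)[/(forces_all leQ)/(_ z)/(forces_imp fQ) h _] := hbranch q.
have /(forces_mem_check fQ) := h q (rf q) zb.
apply: (dense_sub fQ) => r rq [t _ e]; exists t => //.
by apply: (forces_mem_eql fQ) e _; apply: (forces_mem_mono fQ) zb.
Qed.

Lemma in_branch_T t q : in_branch t q -> t ∈ T.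
Proof.
have [_ rf _] := fQ.
move=> tb; have /(forces_and leQ)[/(forces_all leQ)/(_ (check Q t))/(forces_imp fQ) h _] := hbranch q.
by have /(forces_mem_checkE fQ) := h q (rf q) tb.
Qed.

Lemma in_branch_chain s t q : in_branch s q -> in_branch t q -> leT R s t \/ leT R t s.
Proof.
have [_ rf _] := fQ; move=> sb tb.
have /(forces_and leQ)[_ /(forces_and leQ)[/(forces_all leQ)/(_ (check Q s)) h _]] := hbranch q.
have /(forces_imp fQ)/(_ q (rf q)) {}h := iffLR (forces_all _ _ _ _) h (check Q t).
have /(forces_or leQ)/(_ q (rf q))[r rq] := h (conj sb tb).
by case=> /(forces_rel fQ)/(forces_opairN_mem_check fQ); [left | right].
Qed.

Lemma in_branch_down s t q : in_branch t q -> leT R s t -> in_branch s q.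
Proof.
have [_ rf _] := fQ; move=> tb st; have [sT _] := leT_dom tT st.
have /(forces_and leQ)[_ /(forces_and leQ)[_ /(forces_and leQ)[/(forces_all leQ)/(_ (check Q t)) h _]]] := hbranch q.
have /(forces_imp fQ)/(_ q (rf q)) {}h := iffLR (forces_all _ _ _ _) h (check Q s).
apply: h; split=> //; split; first by apply/(forces_mem_checkE fQ).
by apply/(forces_rel fQ)/(forces_opairN_mem_check fQ).
Qed.

Lemma in_branch_level a q : a ∈ omega1 ->
  exists r s, [/\ leQ r q, level T R a s & in_branch s r].
Proof.
have [_ rf tr] := fQ; move=> aw; pose L := Defs.set_of (level T R a).
have /(forces_and leQ)[_ /(forces_and leQ)[_ /(forces_and leQ)[_ /(forces_all leQ)/(_ (check Q L)) h]]] := hbranch q.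
move/(forces_imp fQ)/(_ q (rf q)): h => h.
have /h/(forces_ex leQ)/(_ q (rf q))[r rq [x [xL xb]]] :
    forces leQ q (scons (check Q L) (nth (check Q emptyV)
      [:: b; check Q T; check Q R; check Q (levels T R)])) (fMem 0 4).
  by apply/(forces_mem_checkE fQ); rewrite inVE elts_levels; exists a.
have /(forces_mem_check fQ)/(_ r (rf r))[r' r'r [s sL e]] := xL.
exists r', s; split; first exact: tr rq.
  by rewrite inVE elts_level in sL.
by apply: (forces_mem_eql fQ) e _; apply: (forces_mem_mono fQ) xb.
Qed.

Lemma in_branch_not_ground (E : set V) q : E `<=` elts T ->
  (forall t, E t -> in_branch t q) ->
  ~ (forall r t, leQ r q -> in_branch t r -> E t).
Proof.
have [_ rf _] := fQ; move=> ET Eb bE.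
have eE : elts (Defs.set_of E) = E by apply: elts_set_of; apply: small_sub ET (small_elts _).
suff : forces_eq leQ b (check Q (Defs.set_of E)) q by exact: (@hnew (Defs.set_of E) q q (rf q)).
apply: (forces_eq_ext fQ) => z r rq; split.
  move=> /mem_branch h; apply/(forces_mem_check fQ); apply: (dense_sub fQ) h => s sr [t tb e].
  exists t => //; rewrite inVE eE; apply: bE tb; case: fQ => _ _; apply; [exact: sr | exact: rq].
move=> /(forces_mem_check fQ) h; apply: (forces_mem_stable fQ); apply: (dense_sub fQ) h => s sr [t tE e].
apply: (forces_mem_eql fQ (forces_eq_sym fQ e)); apply: (@in_branch_open _ q); last by apply: Eb; rewrite -eE.
by case: fQ => _ _; apply; [exact: sr | exact: rq].
Qed.

(** If q forces the branch to stay below x, consider the nodes below x which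
    some extension of q keeps out of the branch.  If there are none, the branch
    is the set of all nodes below x; otherwise let m be the least one, and some
    extension makes the branch the set of predecessors of m.  Both are sets
    of V. *)
Lemma in_branch_leaves x q : is_point T R x ->
  exists r t, [/\ leQ r q, in_branch t r & ~ lept R (Node t) x].
Proof.
have [_ rf tr] := fQ; move=> px; apply: contrapT => no.
have inx r t : leQ r q -> in_branch t r -> lept R (Node t) x.
  by move=> rq tb; apply: contrapT => n; apply: no; exists r, t.
pose A := [set u | [/\ u ∈ T, lept R (Node u) x &
  exists2 r, leQ r q & forall r', leQ r' r -> ~ in_branch u r']].
have [A0|Ane] := pselect (A !=set0); last first.
  apply: (@in_branch_not_ground [set u | u ∈ T /\ lept R (Node u) x] q).
  - by move=> u [].
  - move=> u [uT ux]; apply: in_branch_stable => r rq; apply: contrapT => n.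
    apply: Ane; exists u; split=> //; exists r => // r' r'r ub; apply: n.
    by exists r'.
  - by move=> r t rq tb; split; [apply: in_branch_T tb | apply: inx tb].
have [m [mT mx [r rq rm]] mmin] := tree_min hT (fun u '(And3 h _ _) => h) A0.
have pm : ple T R (Node m) x by split.
apply: (@in_branch_not_ground (below R m) r).
- by move=> u [/(leT_dom tT)[]].
- move=> u [um une]; have [uT _] := leT_dom tT um.
  have ux : ple T R (Node u) x by apply: (ple_tr tT) pm; split.
  apply: in_branch_stable => r' r'r; apply: contrapT => n.
  apply: une; apply: mmin => //; split=> //; first by case: ux.
  exists r'; first exact: tr rq.
  by move=> r'' r''r ub; apply: n; exists r''.
- move=> r' t r'r tb.
  have tx : ple T R (Node t) x.
    by split=> //; [apply: in_branch_T tb | apply: inx tb; apply: tr rq].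
  have [[_ _ tm]|[_ _ mt]] := ple_lin tT tx pm.
    split=> // e; rewrite e in tb; exact: rm r'r tb.
  by case: (rm r' r'r); apply: in_branch_down mt.
Qed.

End BranchName.

(** * Collapsing by the product *)

Lemma forcing_notion_prod (P P' : Type) (le : P -> P -> Prop) (le' : P' -> P' -> Prop) :
  forcing_notion le -> forcing_notion le' -> forcing_notion (prod_le le le').
Proof.
move=> [[p _] rf tr] [[p' _] rf' tr']; split; first by exists (p, p').
  by move=> r; split.
by move=> x y z [h h'] [k k']; split; [apply: tr k | apply: tr' k'].
Qed.

Lemma forcing_notion_sealing (T R : V) (SS TT : set V) (p : sealing T R SS TT) :
  forcing_notion (sealing_le (T := T) (R := R) (SS := SS) (TT := TT)).
Proof.
split; first by exists p.
  by move=> q; split.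
by move=> x y z [h h'] [k k']; split=> [a n /k/h|M /k'/h'].
Qed.

Section Product.
Context (T R : V) (SS TT : set V).
Hypothesis hT : omega1_tree T R.
Hypothesis hmeets : has_meets T R.
Hypothesis hST : appropriate SS TT.
Hypothesis hTN : forall N : V, SS N \/ TT N -> opair T R ∈ N.
Context (Q : smallType) (leQ : Q -> Q -> Prop).
Hypothesis hQ : forcing_notion leQ.
Context (b : PName Q).
Hypothesis hbranch : forced leQ (f_branch 0 1 2 3)
    [:: b; check Q T; check Q R; check Q (levels T R)].
Hypothesis hnew : forall x : V, forced leQ (fNot (fEq 0 1)) [:: b; check Q x].

Let tT : is_tree T R. Proof. by case: hT. Qed.
Let rQ q : leQ q q. Proof. by case: hQ. Qed.
Let trQ q p r : leQ p q -> leQ q r -> leQ p r.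
Proof. by case: hQ => _ _; apply. Qed.

Local Notation in_b := (in_branch leQ b).

(** The one way in which b can fail to leave countably many points at a single
    level.  It makes the other factor of the product superfluous, see
    forces_equinumerous_of_trapped. *)
Definition trapped (C : set Defs.point) (q : Q) (s : V) : Prop :=
  [/\ countable C, C `<=` is_point T R, in_b s q &
    forall r t, leQ r q -> leT R s t -> in_b t r ->
      exists2 x, C x & lept R (Node t) x].

(** Each single point of C is left by b at some level, because b is new.  These
    countably many levels are cofinal: a node of b at level a is still below
    some x in C, so b leaves that x above level a. *)
Lemma forces_equinumerous_of_trapped (P : Type) (leP : P -> P -> Prop)
    (fP : forcing_notion leP) C p q s (v : nat -> PName (P * Q)) :
  trapped C q s -> v 0 = check _ omega1 -> v 1 = check _ omega ->
  forces (prod_le leP leQ) (p, q) v (f_equinumerous 0 1).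
Proof.
move=> [cC Cpt sb Ccov]; have [_ rP _] := fP.
have /countable_injP[code codeI] := cC.
pose B t (r : P * Q) := in_b t r.2.
pose G i t r := B t r /\ exists2 x, C x & code x = i /\ ~ lept R (Node t) x.
apply: (@forces_equinumerous_of_cofinal _ _ (forcing_notion_prod fP hQ) T R hT B G).
- by move=> s' t r; apply: (in_branch_chain hQ hbranch).
- move=> i t r r' [_ r'r] [tb h]; split=> //; exact: (in_branch_open hQ) r'r tb.
- by move=> i t r [].
- by move=> t r; apply: (in_branch_T hQ hbranch).
move=> [p2 q2] a [p2p /= q2q] aw.
have [q3 [u [q32 au ub]]] := in_branch_level hQ hbranch q2 aw.
have q3q := trQ q32 q2q.
have sb3 : in_b s q3 by apply: (in_branch_open hQ) sb.
have [w [wb sw uw]] : exists w, [/\ in_b w q3, leT R s w & leT R u w].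
  have [sT uT] := (in_branch_T hQ hbranch sb3, in_branch_T hQ hbranch ub).
  case: (in_branch_chain hQ hbranch sb3 ub) => h; [exists u | exists s];
    by split=> //; apply: (leT_refl tT).
have [x Cx wx] := Ccov q3 w q3q sw wb.
have [q4 [t [q43 tb tx]]] := in_branch_leaves hT hQ hbranch hnew q3 (Cpt x Cx).
exists (p2, q4), u, (code x), t; split=> //.
- by split=> //=; apply: trQ q32.
- by split=> //; exists x.
move=> [p5 q5] t' [_ /= q54] [t'b [x' Cx' [ex t'x]]].
have exx : x' = x by apply: codeI => //; apply/mem_set.
rewrite exx in t'x.
have wb5 : in_b w q5 by apply: (in_branch_open hQ) wb; apply: trQ q43.
case: (in_branch_chain hQ hbranch wb5 t'b) => h; first exact: (leT_tr tT) uw h.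
case: t'x.
have h1 : ple T R (Node t') (Node w).
  by split=> //=; [apply: (in_branch_T hQ hbranch) t'b | apply: (in_branch_T hQ hbranch) wb5].
have h2 : ple T R (Node w) x.
  by split; [apply: (in_branch_T hQ hbranch) wb5 | apply: Cpt |].
by case: (ple_tr tT h1 h2).
Qed.

(** If b is trapped nowhere below q, it has a node off all the points which
    constrain a condition p1: those of the domain of its function and the
    branches in its countable models.  At such a node the function can take
    any large value.  A transitive model contains all of T, so it puts no
    constraint on nodes. *)
Lemma sealing_grows_along_branch q (p1 : sealing T R SS TT) q1 s n :
  ~ (exists C q1 s, leQ q1 q /\ trapped C q1 s) -> leQ q1 q -> in_b s q1 ->
  exists (p2 : sealing T R SS TT) q2 t, [/\ sealing_le p2 p1, leQ q2 q1 & leT R s t] /\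
    in_b t q2 /\ exists2 k, cfun (sval p2) (Node t) = Some k & n <= k.
Proof.
have [[hTT hSS hN] _ _ _] := hST.
have hNel N : (SS `|` TT) N ->
    [/\ Homega2 N, elementary (elts N) Homega2, omega ∈ N & opair T R ∈ N].
  move=> NST; have [h1 h2 _] := hN N NST; split=> //; last exact: hTN.
  by case: NST => [/hSS[]|/hTT[]].
case: p1 => p1 hp1 free q1q sb.
have [[dfin dpt [modN _ _]] _ _ _ _] := hp1.
pose C : set Defs.point := cdom p1 `|` \bigcup_(N in [set N | N \in cmodels p1 /\ SS N])
   [set Branch c | c in [set c | c ∈ N /\ branches T R c]].
have cC : countable C.
  rewrite /C -bigcup2E; apply: bigcup_countable => // -[|[|i]] _ //=.
    exact: finite_set_countable.
  apply: bigcup_countable.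
    apply: finite_set_countable; apply: (@sub_finite_set _ _ [set` cmodels p1]) => //.
    by move=> N [].
  move=> N [_ /hSS[cN _]]; apply: sub_countable (card_image_le _ _) _.
  by apply: sub_countable cN; apply: subset_card_le => c [].
have Cpt : C `<=` is_point T R.
  by move=> x [/dpt//|[N _ [c [_ bc] <-]]].
have [q2 [t [q21 st tb tC]]] : exists q2 t, [/\ leQ q2 q1, leT R s t,
    in_b t q2 & forall x, C x -> ~ lept R (Node t) x].
  apply: contrapT => no; apply: free; exists C, q1, s; split=> //; split=> // q2 t q21 st tb.
  apply: contrapT => n'; apply: no; exists q2, t; split=> // x Cx tx; apply: n'.
  by exists x.
have tT' := in_branch_T hQ hbranch tb.
have rT : exists r, is_root T R r by case: hT.
have [||||p2 [hp2 ext ms [k pk nk]]] :=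
    @extend_condition T R tT hmeets SS TT p1 hp1 rT _ _ t n tT'.
- move=> N u v NM vN uv; have [h1 h2 h3 h4] := hNel N (modN N NM).
  exact: (model_downward h1 h2 h3 hT h4 vN uv).
- move=> N u c d NM uT uN cN dN bc bd uc ud; have [h1 h2 h3 h4] := hNel N (modN N NM).
  exact: (model_split_branch h1 h2 h3 hT h4 uN cN dN bc bd uc ud).
- by move=> x dx; apply: tC; left.
- move=> N c u NM cN bc uT uN tc; case: (modN N NM) => [NS|NT].
    by apply: (tC (Branch c)) => //; right; exists N => //; exists c.
  have [h1 h2 h3 h4] := hNel N (modN N NM).
  have [TN _] := model_TR h2 h4.
  by have [Ntr _] := hTT N NT; apply: uN; apply: (Ntr T TN).
exists (exist _ p2 hp2), q2, t; split; first by split=> //; split=> //= M; rewrite ms.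
by split=> //; exists k.
Qed.

(** Two steps along b give cofinality.  Given a level, a first extension puts a
    node u of b above it into the domain, with value m; a second one reaches the
    value m.+1.  By weak monotonicity every node of b with a value beyond m is
    above u, so the place where b first takes the value m.+1 is above the given
    level. *)
Lemma forces_equinumerous_of_free (p : sealing T R SS TT) q (v : nat -> PName _) :
  ~ (exists C q1 s, leQ q1 q /\ trapped C q1 s) ->
  v 0 = check _ omega1 -> v 1 = check _ omega ->
  forces (prod_le (sealing_le (T := T) (R := R) (SS := SS) (TT := TT)) leQ)
    (p, q) v (f_equinumerous 0 1).
Proof.
move=> free; have fS := forcing_notion_sealing p; have [_ _ trS] := fS.
pose B t (r : sealing T R SS TT * Q) := in_b t r.2.
pose G k t (r : sealing T R SS TT * Q) :=
  B t r /\ exists2 n, cfun (sval r.1) (Node t) = Some n & k <= n.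
apply: (@forces_equinumerous_of_cofinal _ _ (forcing_notion_prod fS hQ) T R hT B G).
- by move=> s t r; apply: (in_branch_chain hQ hbranch).
- move=> k t r r' [[h _] r'r] [tb [n tn kn]]; split; first exact: (in_branch_open hQ) r'r tb.
  by exists n => //; apply: h.
- by move=> k t r [].
- by move=> t r; apply: (in_branch_T hQ hbranch).
move=> [p1 q1] a [_ /= q1q] aw.
have [q2 [s [q21 as_ sb]]] := in_branch_level hQ hbranch q1 aw.
have q2q := trQ q21 q1q.
have [p3 [q3 [u [[p31 q32 su] [ub [m um _]]]]]] :=
  sealing_grows_along_branch p1 0 free q2q sb.
have q3q := trQ q32 q2q.
have [p4 [q4 [t [[p43 q43 ut] [tb [n tn mn]]]]]] :=
  sealing_grows_along_branch p3 m.+1 free q3q ub.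
exists (p4, q4), s, m.+1, t; split=> //.
- split=> /=; first exact: trS _ _ _ p43 p31.
  exact: trQ q43 (trQ q32 q21).
- by split=> //; exists n.
move=> [p5 q5] t' [/= p54 q54] [t'b [n' /= t'n mn']].
have ub5 : in_b u q5 by apply: (in_branch_open hQ) ub; apply: trQ q43.
case: (in_branch_chain hQ hbranch ub5 t'b) => h; first exact: (leT_tr tT) su h.
have um5 : cfun (sval p5) (Node u) = Some m.
  by case: p54 => h5 _; apply: h5; case: p43 => h4 _; apply: h4.
have [_ pmono _ _ _] := svalP p5.
by have := pmono _ _ _ _ t'n um5 h; rewrite leqNgt mn'.
Qed.

End Product.

Theorem theorem5p4 (T R : V) (SS TT : set V)
  (hT : kurepa_tree T R) (hmeets : has_meets T R)
  (hST : appropriate SS TT)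
  (hTH : Homega2 (opair T R))
  (hTN : forall N : V, SS N \/ TT N -> opair T R ∈ N)
  (Q : smallType) (leQ : Q -> Q -> Prop) (hQ : forcing_notion leQ)
  (b : PName Q)
  (hbranch : forced leQ (f_branch 0 1 2 3)
    [:: b; check Q T; check Q R; check Q (levels T R)])
  (hnew : forall x : V, forced leQ (fNot (fEq 0 1)) [:: b; check Q x]) :
  forced (prod_le (sealing_le (T := T) (R := R) (SS := SS) (TT := TT)) leQ)
    (f_equinumerous 0 1) [:: check _ omega1; check _ omega].
Proof.
case: hT => hT1 _ [p0 q0].
have fS := forcing_notion_sealing p0; have [_ rS _] := fS; have [_ rQ _] := hQ.
apply: (forces_stable (forcing_notion_prod fS hQ)) => -[p q] _.
have [[C [q1 [s [q1q tr]]]]|free] :=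
    pselect (exists C q1 s, leQ q1 q /\ trapped T R leQ b C q1 s).
  exists (p, q1); first by split.
  exact: (forces_equinumerous_of_trapped hT1 hQ hbranch hnew fS tr).
exists (p, q); first by split.
exact: (forces_equinumerous_of_free hT1 hmeets hST hTN hQ hbranch free).
Qed.
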